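(* Let $X$ be a locally compact Hausdorff space, let $\mathcal{Q}$ be a separable Hilbert space over $\mathbb{F}\in\{\mathbb{R},\mathbb{C}\}$, and let $K:X\times X\to\mathbb{F}$ be a $\mathcal{C}_0$-kernel with separable reproducing kernel Hilbert space $\mathcal{R}(K)$. Then for any positive operator-valued measure $\nu\in\mathscr{P}(X,\mathcal{Q})$ there exists a unique bounded non-negative definite operator $T_K^{\nu}$ on the Hilbert tensor product $\mathcal{R}(K)\otimes\mathcal{Q}$ satisfying $$\langle T_K^{\nu}(f\otimes\phi),\,g\otimes\psi\rangle_{\mathcal{R}(K)\otimes\mathcal{Q}}=\int_X f(x)\overline{g(x)}\,d\nu_{\phi,\psi}(x)\qquad\text{for all } f,g\in\mathcal{R}(K),\ \phi,\psi\in\mathcal{Q}.$$ It holds that $\|T_K^{\nu}\|_{\mathrm{op}}\le\sup_{x\in X}K(x,x)$. Additionally, $T_K^{\nu}$ is trace-class if and only if the operator $\int_X K(x,x)\,d\nu(x)$ on $\mathcal{Q}$ is trace-class, and in this case the trace norms satisfy $$\|T_K^{\nu}\|_1=\Big\|\int_X K(x,x)\,d\nu(x)\Big\|_1 .$$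
   Context: Inner products are linear in the first and conjugate-linear in the second argument. A kernel is a (Hermitian) positive definite function $K:X\times X\to\mathbb{F}$ in the sense that all its finite Gram matrices are non-negative definite; $\mathcal{R}(K)$ is its reproducing kernel Hilbert space, with feature maps $k_x=K(\cdot,x)$ and $f(x)=\langle f,k_x\rangle$. $K$ is a $\mathcal{C}_0$-kernel if $\sup_{x}K(x,x)<\infty$ and $k_x\in\mathcal{C}_0(X)$ (continuous functions vanishing at infinity) for all $x\in X$; equivalently $\mathcal{R}(K)\subset\mathcal{C}_0(X)$. A positive operator-valued measure (POVM) is a map $\nu$ from the Borel $\sigma$-algebra of $X$ to the non-negative definite bounded operators on $\mathcal{Q}$ with $\nu(\emptyset)=0$, $\nu(X)=I_{\mathcal{Q}}$, and $\nu(\bigcup_k B_k)=\sum_k\nu(B_k)$ in the strong operator topology for every countable family of pairwise disjoint Borel sets. $\mathscr{P}(X,\mathcal{Q})$ is the set of POVMs. For $\phi,\psi\in\mathcal{Q}$, $\nu_{\phi,\psi}(B)=\langle\nu(B)\phi,\psi\rangle_{\mathcal{Q}}$ is an $\mathbb{F}$-valued measure. For bounded measurable $h:X\to\mathbb{F}$, $\int_X h\,d\nu$ is the unique bounded operator on $\mathcal{Q}$ with $\langle(\int_X h\,d\nu)\phi,\psi\rangle=\int_X h\,d\nu_{\phi,\psi}$ for all $\phi,\psi$. *)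

(* Defs.v *)
From HB Require Import structures.
From mathcomp Require Import all_boot all_order all_algebra.
From mathcomp Require Import all_classical all_reals all_analysis.
From mathcomp Require Import complex.
Set Implicit Arguments.
Unset Strict Implicit.
Unset Printing Implicit Defensive.
Import Order.TTheory GRing.Theory Num.Theory.
Import numFieldNormedType.Exports.
Local Open Scope classical_set_scope.
Local Open Scope ring_scope.

Inductive scalar_kind := RealScalars | ComplexScalars.

Definition scalarField (R : realType) (k : scalar_kind) : numFieldType :=
  match k with
  | RealScalars => R
  | ComplexScalars => R[i]
  end.

Section ScalarOperations.
Context {R : realType}.

Definition sc_re {k : scalar_kind} : scalarField R k -> R :=
  match k with
  | RealScalars => fun x => x
  | ComplexScalars => @complex.Re R
  end.

Definition sc_im {k : scalar_kind} : scalarField R k -> R :=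
  match k with
  | RealScalars => fun=> 0
  | ComplexScalars => @complex.Im R
  end.

Definition sc_conj {k : scalar_kind} : scalarField R k -> scalarField R k :=
  match k with
  | RealScalars => fun x => x
  | ComplexScalars => fun z => conjc z
  end.

(* [a + i b]; for real scalars the imaginary part is dropped. *)
Definition sc_mk {k : scalar_kind} : R -> R -> scalarField R k :=
  match k with
  | RealScalars => fun a _ => a
  | ComplexScalars => fun a b => Complex a b
  end.

End ScalarOperations.

Section ScalarLemmas.
Context {R : realType} {k : scalar_kind}.
Implicit Types x y : scalarField R k.

Lemma sc_reD x y : sc_re (x + y) = sc_re x + sc_re y.
Proof. by case: k x y => //= -[a b] [c d]. Qed.

Lemma sc_imD x y : sc_im (x + y) = sc_im x + sc_im y.
Proof. by case: k x y => //= [x y|[a b] [c d] //]; rewrite addr0. Qed.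

Lemma sc_reN x : sc_re (- x) = - sc_re x.
Proof. by case: k x => //= -[a b]. Qed.

Lemma sc_imN x : sc_im (- x) = - sc_im x.
Proof. by case: k x => //= [x|[a b] //]; rewrite oppr0. Qed.

Lemma sc_re0 : sc_re (0 : scalarField R k) = 0.
Proof. by case: k. Qed.

Lemma sc_im0 : sc_im (0 : scalarField R k) = 0.
Proof. by case: k. Qed.

Lemma sc_re_sum n (F : nat -> scalarField R k) :
  sc_re (\sum_(0 <= i < n) F i) = \sum_(0 <= i < n) sc_re (F i).
Proof. exact: (big_morph _ sc_reD sc_re0). Qed.

Lemma sc_im_sum n (F : nat -> scalarField R k) :
  sc_im (\sum_(0 <= i < n) F i) = \sum_(0 <= i < n) sc_im (F i).
Proof. exact: (big_morph _ sc_imD sc_im0). Qed.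

Lemma sc_mk_gt0 (e : R) : 0 < e -> 0 < sc_mk e 0 :> scalarField R k.
Proof. by case: k => //= e0; rewrite ltcE /= eqxx. Qed.

Lemma sc_norm_re x (e : R) : `|x| < sc_mk e 0 -> `|sc_re x| < e.
Proof.
case: k x => //= x; rewrite normc_def ltcE /= eqxx /=; apply: le_lt_trans.
by rewrite -sqrtr_sqr ler_wsqrtr// lerDl sqr_ge0.
Qed.

Lemma sc_norm_im x (e : R) : `|x| < sc_mk e 0 -> `|sc_im x| < e.
Proof.
case: k x => /= x; first by rewrite normr0; exact: le_lt_trans.
rewrite normc_def ltcE /= eqxx /=; apply: le_lt_trans.
by rewrite -sqrtr_sqr ler_wsqrtr// lerDr sqr_ge0.
Qed.

Lemma cvg_sc_re (u : nat -> scalarField R k) (l : scalarField R k) :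
  u @ \oo --> l -> (fun n => sc_re (u n)) @ \oo --> sc_re l.
Proof.
move=> /cvgrPdist_lt ul; apply/cvgrPdist_lt => e e0.
near=> n; rewrite -sc_reN -sc_reD; apply: sc_norm_re.
by near: n; apply: ul; exact: sc_mk_gt0.
Unshelve. all: by end_near. Qed.

Lemma cvg_sc_im (u : nat -> scalarField R k) (l : scalarField R k) :
  u @ \oo --> l -> (fun n => sc_im (u n)) @ \oo --> sc_im l.
Proof.
move=> /cvgrPdist_lt ul; apply/cvgrPdist_lt => e e0.
near=> n; rewrite -sc_imN -sc_imD; apply: sc_norm_im.
by near: n; apply: ul; exact: sc_mk_gt0.
Unshelve. all: by end_near. Qed.

Lemma sc_conjM x y : sc_conj (x * y) = sc_conj x * sc_conj y.
Proof. by case: k x y => //= x y; rewrite rmorphM. Qed.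

Lemma sc_conjD x y : sc_conj (x + y) = sc_conj x + sc_conj y.
Proof. by case: k x y => //= x y; rewrite rmorphD. Qed.

Lemma sc_conjN x : sc_conj (- x) = - sc_conj x.
Proof. by case: k x => //= x; rewrite rmorphN. Qed.

Lemma sc_conjK x : sc_conj (sc_conj x) = x.
Proof. by case: k x => //= -[a b] /=; rewrite opprK. Qed.

Lemma sc_mul_conj x : x * sc_conj x = `|x| ^+ 2.
Proof.
case: k x => /= x; first by rewrite real_normK ?num_real.
by rewrite sqr_normc.
Qed.

Lemma sc_conj_ge0 x : 0 <= x -> sc_conj x = x.
Proof.
case: k x => //= -[a b]; rewrite lecE /= => /andP[/eqP-> _].
by rewrite oppr0.
Qed.

End ScalarLemmas.

HB.mixin Record CompleteNormedModule_isHilbert (R : realType) (k : scalar_kind)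
    H & CompleteNormedModule (scalarField R k) H := {
  inner : H -> H -> scalarField R k ;
  innerP : forall (a : scalarField R k) (x y z : H),
    inner (a *: x + y) z = a * inner x z + inner y z ;
  inner_conj : forall x y : H, inner y x = sc_conj (inner x y) ;
  inner_norm : forall x : H, inner x x = `|x| ^+ 2
}.

#[short(type="hilbertType")]
HB.structure Definition Hilbert (R : realType) (k : scalar_kind) :=
  {H of CompleteNormedModule_isHilbert R k H
   & CompleteNormedModule (scalarField R k) H}.

Section InnerLemmas.
Context {R : realType} {k : scalar_kind} {H : hilbertType R k}.
Implicit Types x y z : H.

Lemma innerDl x y z : inner (x + y) z = inner x z + inner y z.
Proof. by have := innerP 1 x y z; rewrite scale1r mul1r. Qed.

Lemma inner0l z : inner 0 z = 0.
Proof. by apply: (addrI (inner 0 z)); rewrite -innerDl !addr0. Qed.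

Lemma innerZl a x z : inner (a *: x) z = a * inner x z.
Proof. by have := innerP a x 0 z; rewrite addr0 inner0l addr0. Qed.

Lemma innerNl x z : inner (- x) z = - inner x z.
Proof. by rewrite -scaleN1r innerZl mulN1r. Qed.

Lemma innerDr x y z : inner z (x + y) = inner z x + inner z y.
Proof. by rewrite !(inner_conj _ z) innerDl sc_conjD. Qed.

Lemma innerZr a x z : inner z (a *: x) = sc_conj a * inner z x.
Proof. by rewrite !(inner_conj _ z) innerZl sc_conjM. Qed.

Lemma inner_suml n (F : nat -> H) z :
  inner (\sum_(0 <= i < n) F i) z = \sum_(0 <= i < n) inner (F i) z.
Proof.
exact: (big_morph (fun x => inner x z) (fun x y => innerDl x y z) (inner0l z)).
Qed.

Lemma cauchy_schwarz x y : `|inner x y| <= `|x| * `|y|.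
Proof.
have [->|y0] := eqVneq y 0.
  by rewrite inner_conj inner0l sc_conj_ge0// !normr0 mulr0.
have n0 : `|y| ^+ 2 != 0 by rewrite expf_neq0// normr_eq0.
pose a := inner x y / `|y| ^+ 2.
have : 0 <= inner (x + (- a) *: y) (x + (- a) *: y).
  by rewrite inner_norm exprn_ge0.
rewrite innerDl innerZl (innerDr x) (innerDr _ _ y) !innerZr !inner_norm.
have -> : inner y x = sc_conj (inner x y) by exact: inner_conj.
have ca : sc_conj (- a) = - (sc_conj (inner x y) / `|y| ^+ 2).
  by rewrite sc_conjN sc_conjM (@sc_conj_ge0 _ _ (_^-1)) ?invr_ge0 ?exprn_ge0.
rewrite ca /a !mulNr.
have -> : - (inner x y / `|y| ^+ 2 *
    (sc_conj (inner x y) + - (sc_conj (inner x y) / `|y| ^+ 2 * `|y| ^+ 2))) = 0.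
  by rewrite divfK// subrr mulr0 oppr0.
rewrite addr0 mulrAC (mulrC (sc_conj _)) sc_mul_conj subr_ge0.
rewrite ler_pdivrMr ?exprn_gt0 ?normr_gt0// -exprMn.
by rewrite ler_sqr ?nnegrE ?mulr_ge0.
Qed.

Lemma cvg_innerl (u : nat -> H) (l z : H) :
  u @ \oo --> l -> (fun n => inner (u n) z) @ \oo --> inner l z.
Proof.
move=> /cvgrPdist_lt ul; apply/cvgrPdist_lt => e e0.
have z0 : 0 < `|z| + 1 by rewrite ltr_wpDl.
near=> n; rewrite -innerNl -innerDl.
apply: (le_lt_trans (cauchy_schwarz _ _)).
apply: (@le_lt_trans _ _ (`|l - u n| * (`|z| + 1))).
  by rewrite ler_wpM2l// lerDl.
rewrite -ltr_pdivlMr//; near: n; apply: ul.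
by rewrite divr_gt0.
Unshelve. all: by end_near. Qed.

End InnerLemmas.

Definition separable (T : topologicalType) : Prop :=
  exists2 A : set T, countable A & dense A.

Section Operators.
Context {R : realType} {k : scalar_kind}.

Definition lin_span {H : hilbertType R k} (E : set H) : set H :=
  [set x | exists n (c : 'I_n -> scalarField R k) (e : 'I_n -> H),
     (forall i, E (e i)) /\ x = \sum_(i < n) c i *: e i].

Definition bounded_operator {H : hilbertType R k} (T : H -> H) : Prop :=
  linear T /\ exists M : scalarField R k, forall x, `|T x| <= M * `|x|.

(* Self-adjointness is automatic over the complex numbers, not over the reals. *)
Definition nonneg_operator {H : hilbertType R k} (T : H -> H) : Prop :=
  (forall x y, inner (T x) y = inner x (T y)) /\
  (forall x, 0 <= inner (T x) x).

Definition op_norm {H : hilbertType R k} (T : H -> H) : R :=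
  sup [set sc_re `|T x| | x in [set x | `|x| <= 1]].

(* [|T| = (T^* T)^(1/2)]: the bounded non-negative [A] with [A^* A = T^* T]. *)
Definition abs_op {H : hilbertType R k} (T : H -> H) : H -> H :=
  xget (fun=> 0) [set A : H -> H | [/\ bounded_operator A, nonneg_operator A &
    forall x y, inner (A x) (A y) = inner (T x) (T y)]].

Definition orthonormal_basis {H : hilbertType R k} (E : set H) : Prop :=
  (forall x y, E x -> E y -> inner x y = (x == y)%:R) /\ dense (lin_span E).

Definition some_basis {H : hilbertType R k} : set H :=
  xget set0 [set E : set H | orthonormal_basis E].

(* [tr |T|], computed in some orthonormal basis. *)
Definition trace_norm {H : hilbertType R k} (T : H -> H) : \bar R :=
  \esum_(e in (some_basis : set H)) (sc_re (inner (abs_op T e) e))%:E.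

Definition trace_class {H : hilbertType R k} (T : H -> H) : Prop :=
  bounded_operator T /\ (trace_norm T < +oo)%E.

End Operators.

(* These axioms determine the Hilbert tensor product up to a unitary equivalence
   compatible with the elementary tensors. *)
Record hilbert_tensor (R : realType) (k : scalar_kind)
    (H1 H2 : hilbertType R k) := HilbertTensor {
  tensor_space :> hilbertType R k ;
  tensor : H1 -> H2 -> tensor_space ;
  tensor_linear_l : forall y, linear (tensor^~ y) ;
  tensor_linear_r : forall x, linear (tensor x) ;
  tensor_inner : forall x1 x2 y1 y2,
    inner (tensor x1 y1) (tensor x2 y2) = inner x1 x2 * inner y1 y2 ;
  tensor_dense : dense (lin_span [set z | exists x y, z = tensor x y])
}.

Section Kernels.
Context {R : realType} {k : scalar_kind}.

Definition posdef_kernel {X : Type} (K : X -> X -> scalarField R k) : Prop :=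
  (forall x y, K y x = sc_conj (K x y)) /\
  (forall n (x : 'I_n -> X) (c : 'I_n -> scalarField R k),
     0 <= \sum_(i < n) \sum_(j < n) sc_conj (c i) * K (x i) (x j) * c j).

Definition C0_function {X : topologicalType} (f : X -> scalarField R k) : Prop :=
  continuous f /\
  forall e : scalarField R k, 0 < e ->
    exists2 C : set X, compact C & forall x, ~ C x -> `|f x| < e.

Definition C0_kernel {X : topologicalType} (K : X -> X -> scalarField R k) : Prop :=
  [/\ posdef_kernel K, has_ubound (range (fun x => sc_re (K x x))) &
      forall x, C0_function (K^~ x)].

(* The Hilbert space of functions on [X] reproduced by [K]; [rk_fun] identifies
   its elements with functions, so [rkhs K] is unique up to unitary equivalence. *)
Record rkhs {X : Type} (K : X -> X -> scalarField R k) := RKHS {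
  rk_space :> hilbertType R k ;
  rk_fun : rk_space -> X -> scalarField R k ;
  rk_fun_linear : forall (a : scalarField R k) f g x,
    rk_fun (a *: f + g) x = a * rk_fun f x + rk_fun g x ;
  rk_fun_inj : injective rk_fun ;
  rk_feature : X -> rk_space ;
  rk_featureE : forall x, rk_fun (rk_feature x) = K^~ x ;
  rk_reproducing : forall f x, rk_fun f x = inner f (rk_feature x)
}.

End Kernels.

Record scalar_measure d (X : measurableType d) (R : realType)
    (k : scalar_kind) := ScalarMeasure {
  smeas :> set X -> scalarField R k ;
  smeas0 : smeas set0 = 0 ;
  smeas_sigma_additive : forall A : nat -> set X,
    (forall i, measurable (A i)) -> trivIset setT A ->
    (fun n => \sum_(0 <= i < n) smeas (A i)) @ \oo --> smeas (\bigcup_i A i)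
}.

Section ScalarIntegral.
Context d (X : measurableType d) (R : realType) (k : scalar_kind).
Variable mu : scalar_measure X R k.

Definition re_charge (B : set X) : \bar R := (sc_re (mu B))%:E.
Definition im_charge (B : set X) : \bar R := (sc_im (mu B))%:E.

Let re_charge0 : re_charge set0 = 0%E.
Proof. by rewrite /re_charge smeas0 sc_re0. Qed.

Let re_charge_fin (B : set X) : measurable B -> re_charge B \is a fin_num.
Proof. by []. Qed.

Let re_charge_sigma : semi_sigma_additive re_charge.
Proof.
move=> A mA tA _; rewrite /re_charge.
under eq_fun do rewrite sumEFin -sc_re_sum.
by apply: cvg_EFin; [exact: nearW|]; apply: cvg_sc_re; exact: smeas_sigma_additive.
Qed.

HB.instance Definition _ :=
  isCharge.Build _ X R re_charge re_charge0 re_charge_fin re_charge_sigma.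

Let im_charge0 : im_charge set0 = 0%E.
Proof. by rewrite /im_charge smeas0 sc_im0. Qed.

Let im_charge_fin (B : set X) : measurable B -> im_charge B \is a fin_num.
Proof. by []. Qed.

Let im_charge_sigma : semi_sigma_additive im_charge.
Proof.
move=> A mA tA _; rewrite /im_charge.
under eq_fun do rewrite sumEFin -sc_im_sum.
by apply: cvg_EFin; [exact: nearW|]; apply: cvg_sc_im; exact: smeas_sigma_additive.
Qed.

HB.instance Definition _ :=
  isCharge.Build _ X R im_charge im_charge0 im_charge_fin im_charge_sigma.

End ScalarIntegral.

Definition hahn_pair d (X : measurableType d) (R : realType)
    (rho : {charge set X -> \bar R}) :
    {PN : set X * set X | hahn_decomposition rho PN.1 PN.2}.
Proof.
have [P h] := cid (Hahn_decomposition rho).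
by have [N hPN] := cid h; exists (P, N).
Qed.

(* Integral against the Jordan decomposition, which does not depend on the
   choice of the Hahn decomposition. *)
Definition charge_integral d (X : measurableType d) (R : realType)
    (rho : {charge set X -> \bar R}) (h : X -> R) : R :=
  let PN := svalP (hahn_pair rho) in
  (\int[jordan_pos PN]_(x in setT) h x) - (\int[jordan_neg PN]_(x in setT) h x).

Definition scalar_integral d (X : measurableType d) (R : realType)
    (k : scalar_kind) (mu : scalar_measure X R k) (h : X -> scalarField R k) :
    scalarField R k :=
  sc_mk
    (charge_integral (re_charge mu) (fun x => sc_re (h x)) -
     charge_integral (im_charge mu) (fun x => sc_im (h x)))
    (charge_integral (im_charge mu) (fun x => sc_re (h x)) +
     charge_integral (re_charge mu) (fun x => sc_im (h x))).

Notation borel X := (g_sigma_algebraType (@open X)).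

(* Values on non-measurable sets are irrelevant. *)
Record povm d (X : measurableType d) (R : realType) (k : scalar_kind)
    (Q : hilbertType R k) := POVM {
  povm_op :> set X -> Q -> Q ;
  povm_bounded : forall B, measurable B -> bounded_operator (povm_op B) ;
  povm_nonneg : forall B, measurable B -> nonneg_operator (povm_op B) ;
  povm0 : forall phi, povm_op set0 phi = 0 ;
  povmT : forall phi, povm_op setT phi = phi ;
  povm_sigma_additive : forall A : nat -> set X,
    (forall i, measurable (A i)) -> trivIset setT A ->
    forall phi, (fun n => \sum_(0 <= i < n) povm_op (A i) phi) @ \oo -->
      povm_op (\bigcup_i A i) phi
}.

Section PovmIntegral.
Context d (X : measurableType d) (R : realType) (k : scalar_kind).
Context (Q : hilbertType R k) (nu : povm X Q).

Definition povm_coef (phi psi : Q) (B : set X) : scalarField R k :=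
  inner (nu B phi) psi.

Lemma povm_coef0 phi psi : povm_coef phi psi set0 = 0.
Proof. by rewrite /povm_coef povm0 inner0l. Qed.

Lemma povm_coef_sigma_additive phi psi (A : nat -> set X) :
  (forall i, measurable (A i)) -> trivIset setT A ->
  (fun n => \sum_(0 <= i < n) povm_coef phi psi (A i)) @ \oo -->
    povm_coef phi psi (\bigcup_i A i).
Proof.
move=> mA tA; rewrite /povm_coef.
under eq_fun do rewrite -inner_suml.
by apply: cvg_innerl; exact: povm_sigma_additive.
Qed.

Definition povm_measure (phi psi : Q) : scalar_measure X R k :=
  ScalarMeasure (povm_coef0 phi psi) (@povm_coef_sigma_additive phi psi).

(* For bounded measurable [h] such an operator exists and is unique. *)
Definition povm_integral (h : X -> scalarField R k) : Q -> Q :=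
  xget (fun=> 0) [set S : Q -> Q | bounded_operator S /\
    forall phi psi, inner (S phi) psi = scalar_integral (povm_measure phi psi) h].

End PovmIntegral.

Section KernelPovmOperator.
Context (X : ptopologicalType) (R : realType) (k : scalar_kind).
Context (Q : hilbertType R k) (K : X -> X -> scalarField R k).
Context (HK : rkhs K) (HKQ : hilbert_tensor HK Q) (nu : povm (borel X) Q).

Definition is_kernel_povm_operator (T : HKQ -> HKQ) : Prop :=
  [/\ bounded_operator T, nonneg_operator T &
    forall (f g : HK) (phi psi : Q),
      inner (T (tensor HKQ f phi)) (tensor HKQ g psi) =
      scalar_integral (povm_measure nu phi psi)
        (fun x => rk_fun f x * sc_conj (rk_fun g x))].

End KernelPovmOperator.

(* Main.v *)
Require Import Defs.
From HB Require Import structures.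
From mathcomp Require Import all_boot all_order all_algebra.
From mathcomp Require Import all_classical all_reals all_analysis.
From mathcomp Require Import measurable_realfun complex ring lra.
Set Implicit Arguments.
Unset Strict Implicit.
Unset Printing Implicit Defensive.
Import Order.TTheory GRing.Theory Num.Theory.
Import numFieldNormedType.Exports.
Local Open Scope classical_set_scope.
Local Open Scope ring_scope.

(** Let (f_i), (e_j) be orthonormal bases of R(K) and Q. A scalar integral is the
    limit of Riemann sums over a fine tagged partition (B, x_B), so for
    z = sum_ij c_ij (f_i tensor e_j) the sesquilinear form on the right-hand side is
    the limit of sum_B <nu(B) w_B, w_B> with w_B = sum_i f_i(x_B) phi_i and
    phi_i = sum_j c_ij e_j. By Cauchy-Schwarz each term is at most
    K(x_B,x_B) sum_i <nu(B) phi_i, phi_i>, and summing over B bounds the form by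
    sup K |z|^2. The matrix of the form in the basis f_i tensor e_j therefore defines
    a bounded non-negative operator T.

    For T >= 0 the trace norm is the trace, because non-negative square roots are
    unique. The trace does not depend on the basis: if (g_n) is obtained by
    Gram-Schmidt for the form <T x, y>, then <T x, x> = sum_n |<x, T g_n>|^2, so the
    trace is sum_n |T g_n|^2 in every basis. In the basis f_i tensor e_j it equals
    sum_j sum_i \int |f_i|^2 d nu_jj = sum_j \int K(x,x) d nu_jj, the trace of
    \int K(x,x) d nu. *)

(** * Scalars *)

(** The scalar integral is defined through Hahn decompositions of the real and imaginary parts of
    nu_{phi,psi}, and these decompositions vary with phi and psi in no controlled way. Linearity in
    phi and psi, symmetry and positivity therefore cannot be read off the definition. They are
    evident for Riemann sums, and they survive the limit because the Riemann error depends on the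
    measure only through a constant: one sequence of partitions serves all the measures at once.

    [abs_op] and [some_basis] are arbitrary choices. The set from which the first is chosen contains
    T itself when T is non-negative, so uniqueness pins it down. The second is a set of vectors that
    comes with no enumeration, so the trace is computed for Parseval families over arbitrary index
    types.

    A statement about all vectors is usually reduced to a basis by one device: the vectors that
    satisfy it form a closed subspace, and this subspace contains a total family. *)

Section Scalars.
Context {R : realType} {k : scalar_kind}.
Local Notation F := (scalarField R k).
Implicit Types (x y : F) (a b : R).

Definition sc_ofR a : F := sc_mk a 0.
(** The norm of F takes its values in F, whose order is only partial over the complex numbers;
    estimates are moved to R, where real arithmetic applies. *)
Definition sc_nm x : R := sc_re `|x|.

Lemma sc_eq x y : sc_re x = sc_re y -> sc_im x = sc_im y -> x = y.
Proof. by case: k x y => [//|[? ?] [? ?]] /= -> ->. Qed.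

Lemma sc_re_mk a b : sc_re (sc_mk a b : F) = a.
Proof. by case: k. Qed.

Lemma sc_re_ofR a : sc_re (sc_ofR a) = a.
Proof. exact: sc_re_mk. Qed.

Lemma sc_im_ofR a : sc_im (sc_ofR a) = 0.
Proof. by rewrite /sc_ofR; case: k. Qed.

Lemma sc_reM x y : sc_re (x * y) = sc_re x * sc_re y - sc_im x * sc_im y.
Proof. by case: k x y => [x y|[? ?] [? ?]] //=; rewrite mulr0 subr0. Qed.

Lemma sc_imM x y : sc_im (x * y) = sc_re x * sc_im y + sc_im x * sc_re y.
Proof. by case: k x y => [x y|[? ?] [? ?]] //=; rewrite mulr0 mul0r addr0. Qed.

Lemma sc_re_conj x : sc_re (sc_conj x) = sc_re x.
Proof. by case: k x => [//|[? ?]]. Qed.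

Lemma sc_im_conj x : sc_im (sc_conj x) = - sc_im x.
Proof. by case: k x => [x|[? ?]] //=; rewrite oppr0. Qed.

Lemma sc_re1 : sc_re (1 : F) = 1. Proof. by case: k. Qed.

Lemma sc_im1 : sc_im (1 : F) = 0. Proof. by case: k. Qed.

Lemma sc_ge0P x : 0 <= x -> 0 <= sc_re x /\ sc_im x = 0.
Proof.
by case: k x => [x //|[a b]]; rewrite lecE /= => /andP[/eqP -> ->].
Qed.

Lemma sc_ge0 x : 0 <= sc_re x -> sc_im x = 0 -> 0 <= x.
Proof. by case: k x => [x //|[a b]] /=; rewrite lecE /= => -> ->; rewrite eqxx. Qed.

Lemma sc_ofR_ge0 a : 0 <= a -> 0 <= sc_ofR a.
Proof. by move=> ?; apply: sc_ge0; rewrite ?sc_re_ofR ?sc_im_ofR. Qed.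

Lemma sc_ofR_re x : 0 <= x -> sc_ofR (sc_re x) = x.
Proof. by move=> /sc_ge0P [_ i0]; apply: sc_eq; rewrite ?sc_re_ofR ?sc_im_ofR. Qed.

Lemma sc_le x y : x <= y -> sc_re x <= sc_re y.
Proof. by rewrite -subr_ge0 => /sc_ge0P[]; rewrite sc_reD sc_reN subr_ge0. Qed.

Lemma sc_ofRD a b : sc_ofR (a + b) = sc_ofR a + sc_ofR b.
Proof. by apply: sc_eq; rewrite ?sc_reD ?sc_imD ?sc_re_ofR ?sc_im_ofR ?addr0. Qed.

Lemma sc_ofRN a : sc_ofR (- a) = - sc_ofR a.
Proof. by apply: sc_eq; rewrite ?sc_reN ?sc_imN ?sc_re_ofR ?sc_im_ofR ?oppr0. Qed.

Lemma sc_ofRM a b : sc_ofR (a * b) = sc_ofR a * sc_ofR b.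
Proof.
by apply: sc_eq; rewrite ?sc_reM ?sc_imM ?sc_re_ofR ?sc_im_ofR ?mulr0 ?mul0r ?subr0 ?addr0.
Qed.

Lemma sc_ofR0 : sc_ofR 0 = 0.
Proof. by apply: sc_eq; rewrite ?sc_re_ofR ?sc_im_ofR ?sc_re0 ?sc_im0. Qed.

Lemma sc_ofR1 : sc_ofR 1 = 1.
Proof. by apply: sc_eq; rewrite ?sc_re_ofR ?sc_im_ofR ?sc_re1 ?sc_im1. Qed.

Lemma sc_ofR_le a b : (sc_ofR a <= sc_ofR b) = (a <= b).
Proof.
apply/idP/idP => [/sc_le|ab]; rewrite ?sc_re_ofR //.
by rewrite -subr_ge0 -sc_ofRN -sc_ofRD sc_ofR_ge0 // subr_ge0.
Qed.

Lemma sc_ofR_lt a b : (sc_ofR a < sc_ofR b) = (a < b).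
Proof.
rewrite !lt_neqAle sc_ofR_le; congr (~~ _ && _).
by apply/eqP/eqP => [/(congr1 sc_re)|-> //]; rewrite !sc_re_ofR.
Qed.

Lemma sc_ofR_gt0 a : 0 < a -> 0 < sc_ofR a.
Proof. by move=> a0; rewrite -sc_ofR0 sc_ofR_lt. Qed.

Lemma sc_re_gt0 x : 0 < x -> 0 < sc_re x.
Proof. by move=> x0; rewrite -sc_ofR_lt sc_ofR0 sc_ofR_re// ltW. Qed.

Lemma sc_conj_ofR a : sc_conj (sc_ofR a) = sc_ofR a.
Proof. by apply: sc_eq; rewrite ?sc_re_conj ?sc_im_conj ?sc_im_ofR ?oppr0. Qed.

Lemma sc_conj0 : sc_conj (0 : F) = 0. Proof. by rewrite -sc_ofR0 sc_conj_ofR. Qed.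

Lemma sc_conj1 : sc_conj (1 : F) = 1. Proof. by rewrite -sc_ofR1 sc_conj_ofR. Qed.

Lemma sc_nmE x : sc_ofR (sc_nm x) = `|x|.
Proof. by rewrite /sc_nm sc_ofR_re. Qed.

Lemma sc_nm_ge0 x : 0 <= sc_nm x.
Proof. by have [] := sc_ge0P (normr_ge0 x). Qed.

Lemma sc_nm0 : sc_nm 0 = 0. Proof. by rewrite /sc_nm normr0 sc_re0. Qed.

Lemma sc_nmM x y : sc_nm (x * y) = sc_nm x * sc_nm y.
Proof. by rewrite {1}/sc_nm normrM -!sc_nmE -sc_ofRM sc_re_ofR. Qed.

Lemma sc_nmD x y : sc_nm (x + y) <= sc_nm x + sc_nm y.
Proof. by rewrite -sc_ofR_le sc_ofRD !sc_nmE ler_normD. Qed.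

Lemma sc_nmN x : sc_nm (- x) = sc_nm x. Proof. by rewrite /sc_nm normrN. Qed.

Lemma sc_nm_ofR a : sc_nm (sc_ofR a) = `|a|.
Proof.
wlog a0 : a / 0 <= a => [h|].
  by have [/h //|/ltW] := leP 0 a; rewrite -oppr_ge0 => /h; rewrite sc_ofRN sc_nmN normrN.
by rewrite /sc_nm ger0_norm ?sc_ofR_ge0// sc_re_ofR ger0_norm.
Qed.

Lemma sc_ofRX a n : sc_ofR (a ^+ n) = sc_ofR a ^+ n.
Proof. by elim: n => [|n ih]; rewrite ?expr0 ?sc_ofR1// !exprS sc_ofRM ih. Qed.

Lemma sc_nm_sqr x : sc_nm x ^+ 2 = sc_re (x * sc_conj x).
Proof. by rewrite sc_mul_conj -sc_nmE -sc_ofRX sc_re_ofR. Qed.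

Lemma sc_nm_sqrE x : sc_nm x ^+ 2 = sc_re x ^+ 2 + sc_im x ^+ 2.
Proof. by rewrite sc_nm_sqr sc_reM sc_re_conj sc_im_conj; ring. Qed.

Lemma sc_nm_conj x : sc_nm (sc_conj x) = sc_nm x.
Proof.
by apply/eqP; rewrite -(@eqrXn2 _ 2) ?sc_nm_ge0// !sc_nm_sqrE sc_re_conj sc_im_conj sqrrN.
Qed.

Lemma sc_nm_eq0 x : sc_nm x = 0 -> x = 0.
Proof. by move=> /(congr1 sc_ofR); rewrite sc_nmE sc_ofR0 => /eqP; rewrite normr_eq0 => /eqP. Qed.

Lemma sc_mulconj x : x * sc_conj x = sc_ofR (sc_nm x ^+ 2).
Proof. by rewrite sc_mul_conj -sc_nmE sc_ofRX. Qed.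

Lemma sc_re_le_nm x : `|sc_re x| <= sc_nm x.
Proof.
rewrite -(@ler_sqr _ `|_|) ?nnegrE ?sc_nm_ge0//.
by rewrite sc_nm_sqrE real_normK ?num_real// lerDl sqr_ge0.
Qed.

Lemma sc_im_le_nm x : `|sc_im x| <= sc_nm x.
Proof.
rewrite -(@ler_sqr _ `|_|) ?nnegrE ?sc_nm_ge0//.
by rewrite sc_nm_sqrE real_normK ?num_real// lerDr sqr_ge0.
Qed.

Lemma sc_nm_le x : sc_nm x <= `|sc_re x| + `|sc_im x|.
Proof.
rewrite -(@ler_sqr _ (sc_nm x)) ?nnegrE ?sc_nm_ge0 ?addr_ge0//.
rewrite sc_nm_sqrE sqrrD !real_normK ?num_real// addrAC lerDl.
by rewrite mulrn_wge0// mulr_ge0.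
Qed.

Lemma sc_nm_sum (I : Type) (r : seq I) (G : I -> F) :
  sc_nm (\sum_(i <- r) G i) <= \sum_(i <- r) sc_nm (G i).
Proof.
elim/big_rec2 : _ => [|i u v _ h]; first by rewrite sc_nm0.
by apply: le_trans (sc_nmD _ _) _; rewrite lerD2l.
Qed.

Lemma sc_re_sumr (I : Type) (r : seq I) (P : pred I) (G : I -> F) :
  sc_re (\sum_(i <- r | P i) G i) = \sum_(i <- r | P i) sc_re (G i).
Proof. exact: (big_morph _ sc_reD sc_re0). Qed.

Lemma sc_im_sumr (I : Type) (r : seq I) (P : pred I) (G : I -> F) :
  sc_im (\sum_(i <- r | P i) G i) = \sum_(i <- r | P i) sc_im (G i).
Proof. exact: (big_morph _ sc_imD sc_im0). Qed.

Lemma sc_conj_sum (I : Type) (r : seq I) (P : pred I) (G : I -> F) :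
  sc_conj (\sum_(i <- r | P i) G i) = \sum_(i <- r | P i) sc_conj (G i).
Proof. exact: (big_morph _ sc_conjD sc_conj0). Qed.

Lemma sc_cvgP (u : nat -> F) (l : F) :
  u @ \oo --> l <-> forall e : R, 0 < e -> \forall n \near \oo, sc_nm (u n - l) < e.
Proof.
split => [/cvgrPdist_lt ul e e0|ul].
  have e1 : 0 < sc_ofR e by rewrite -sc_ofR0 sc_ofR_lt.
  have := ul _ e1; apply: filterS => n.
  by rewrite -sc_nmE sc_ofR_lt -sc_nmN opprB.
apply/cvgrPdist_lt => e e0.
have {}e0 : 0 < sc_re e /\ sc_ofR (sc_re e) = e.
  by split; [rewrite -sc_ofR_lt sc_ofR_re ?ltW ?sc_ofR0|rewrite sc_ofR_re ?ltW].
have := ul _ e0.1; apply: filterS => n.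
by rewrite -[in X in _ -> X]e0.2 -sc_nmE sc_ofR_lt -sc_nmN opprB.
Qed.

Lemma sc_cvg_re_im (u : nat -> F) (a b : R) :
  (k = RealScalars -> b = 0) ->
  (fun n => sc_re (u n)) @ \oo --> a -> (fun n => sc_im (u n)) @ \oo --> b ->
  u @ \oo --> (sc_mk a b : F).
Proof.
move=> b0 /cvgrPdist_lt ua /cvgrPdist_lt ub; apply/sc_cvgP => e e0.
have e2 : 0 < e / 2 by rewrite divr_gt0.
have bE : sc_im (sc_mk a b : F) = b by case: k b0 => // /(_ erefl) ->.
near=> n.
apply: le_lt_trans (sc_nm_le _) _.
rewrite sc_reD sc_imD sc_reN sc_imN sc_re_mk bE (splitr e) ltrD//.
  by rewrite distrC; near: n; exact: ua.
by rewrite distrC; near: n; exact: ub.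
Unshelve. all: by end_near. Qed.

Lemma sc_im_real x : k = RealScalars -> sc_im x = 0.
Proof. by case: k x. Qed.

(** Completeness of F comes coordinatewise from that of R, since the real and imaginary parts are
    additive and 1-Lipschitz. *)
Lemma sc_cauchy (u : nat -> F) :
  (forall e : R, 0 < e -> exists N, forall m n, (N <= m)%N -> (N <= n)%N ->
     sc_nm (u m - u n) < e) ->
  exists l : F, u @ \oo --> l.
Proof.
move=> cu.
have key (g : F -> R) : (forall x, `|g x| <= sc_nm x) ->
   (forall x y, g (x - y) = g x - g y) -> cvg ((fun n => g (u n)) @ \oo).
  move=> gn gB; apply/cauchy_cvgP; apply: cauchy_exP => e e0.
  have [N uN] := cu _ e0; exists (g (u N)).
  exists N => // n /= Nn; rewrite /ball/= -gB.
  by apply: le_lt_trans (gn _) (uN _ _ _ _).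
have /cvg_ex[a ua] := key _ sc_re_le_nm (fun x y => etrans (sc_reD _ _) (congr1 _ (sc_reN _))).
have /cvg_ex[b ub] := key _ sc_im_le_nm (fun x y => etrans (sc_imD _ _) (congr1 _ (sc_imN _))).
exists (sc_mk a b); apply: sc_cvg_re_im => // kR.
apply: (@cvg_unique R^o _ ((fun n => sc_im (u n)) @ \oo)) => //.
have -> : (fun n => sc_im (u n)) = fun=> 0 by apply/funext => n; rewrite sc_im_real.
exact: cvg_cst.
Qed.

Lemma sc_cvg_unique (u : nat -> F) (l m : F) : u @ \oo --> l -> u @ \oo --> m -> l = m.
Proof. by move=> ul um; apply: (@cvg_unique _ _ (u @ \oo)) => //; exact: norm_hausdorff. Qed.

Lemma sc_cvg_conj (u : nat -> F) (l : F) :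
  u @ \oo --> l -> (fun n => sc_conj (u n)) @ \oo --> sc_conj l.
Proof.
move=> /sc_cvgP ul; apply/sc_cvgP => e /ul; apply: filterS => n.
by rewrite -sc_conjN -sc_conjD sc_nm_conj.
Qed.

Lemma sc_cvg_nm_le (u : nat -> F) (l : F) (c : R) :
  u @ \oo --> l -> (forall n, sc_nm (u n) <= c) -> sc_nm l <= c.
Proof.
move=> /sc_cvgP ul uc; apply/ler_addgt0Pl => d /ul[N _ hN].
have /ltW h1 := hN N (leqnn _).
have -> : l = - (u N - l) + u N by rewrite opprB subrK.
by apply: le_trans (sc_nmD _ _) _; rewrite sc_nmN lerD.
Qed.

Lemma sc_cvg_re_le (u : nat -> F) (l : F) (c : R) :
  u @ \oo --> l -> (forall n, sc_re (u n) <= c) -> sc_re l <= c.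
Proof.
move=> /sc_cvgP ul uc; apply/ler_addgt0Pl => d /ul[N _ hN].
have /ltW := hN N (leqnn _); have := uc N; have := sc_re_le_nm (u N - l).
rewrite sc_reD sc_reN ler_norml => /andP[]; lra.
Qed.

Lemma sc_cvg_ge0 (u : nat -> F) (l : F) :
  u @ \oo --> l -> (forall n, 0 <= u n) -> 0 <= l.
Proof.
move=> ul u0; have ul' := ul; move/sc_cvgP: ul' => ul'; apply: sc_ge0.
  rewrite -oppr_le0 -sc_reN; apply: (sc_cvg_re_le (cvgN ul)) => n.
  by rewrite sc_reN oppr_le0; have [] := sc_ge0P (u0 n).
apply: (@cvg_unique R^o _ ((fun n => sc_im (u n)) @ \oo)) => //.
  exact: cvg_sc_im.
have -> : (fun n => sc_im (u n)) = fun=> 0.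
  by apply/funext => n; have [] := sc_ge0P (u0 n).
exact: cvg_cst.
Qed.

Lemma sc_cvg_sum (I : Type) (r : seq I) (u : I -> nat -> F) (l : I -> F) :
  (forall i, u i @ \oo --> l i) ->
  (fun n => \sum_(i <- r) u i n) @ \oo --> \sum_(i <- r) l i.
Proof.
move=> ul; elim: r => [|i r ih].
  by rewrite big_nil; under eq_fun do rewrite big_nil; exact: cvg_cst.
by rewrite big_cons; under eq_fun do rewrite big_cons; exact: cvgD.
Qed.
End Scalars.

(** * Semi-inner products, Bessel, Parseval and Gram-Schmidt *)

Section Forms.
Context {R : realType} {k : scalar_kind}.
Local Notation F := (scalarField R k).

(** Null vectors are allowed so that one theory covers the Hilbert inner product, the form <T x, y>
    of a non-negative operator, the form of [nu] on a cell, and the truncated matrix forms. *)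
Record semi_inner {H : lmodType F} (s : H -> H -> F) : Prop := SemiInner {
  si_lin : forall a x y z, s (a *: x + y) z = a * s x z + s y z ;
  si_conj : forall x y, s y x = sc_conj (s x y) ;
  si_ge0 : forall x, 0 <= s x x
}.

Definition form_sq {H : lmodType F} (s : H -> H -> F) (x : H) : R := sc_re (s x x).

Section Basic.
Context {H : lmodType F} {s : H -> H -> F} (sP : semi_inner s).
Implicit Types (x y z : H) (a : F).
Local Notation N := (form_sq s).

Lemma siDl x y z : s (x + y) z = s x z + s y z.
Proof. by have := si_lin sP 1 x y z; rewrite scale1r mul1r. Qed.

Lemma si0l z : s 0 z = 0.
Proof. by apply: (addrI (s 0 z)); rewrite -siDl !addr0. Qed.

Lemma siZl a x z : s (a *: x) z = a * s x z.
Proof. by have := si_lin sP a x 0 z; rewrite addr0 si0l addr0. Qed.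

Lemma siNl x z : s (- x) z = - s x z.
Proof. by rewrite -scaleN1r siZl mulN1r. Qed.

Lemma siBl x y z : s (x - y) z = s x z - s y z.
Proof. by rewrite siDl siNl. Qed.

Lemma siDr x y z : s z (x + y) = s z x + s z y.
Proof. by rewrite !(si_conj sP _ z) siDl sc_conjD. Qed.

Lemma si0r z : s z 0 = 0.
Proof. by rewrite (si_conj sP) si0l sc_conj0. Qed.

Lemma siZr a x z : s z (a *: x) = sc_conj a * s z x.
Proof. by rewrite !(si_conj sP _ z) siZl sc_conjM. Qed.

Lemma siNr x z : s z (- x) = - s z x.
Proof. by rewrite !(si_conj sP _ z) siNl sc_conjN. Qed.

Lemma siBr x y z : s z (x - y) = s z x - s z y.
Proof. by rewrite siDr siNr. Qed.

Lemma si_suml (I : Type) (r : seq I) (P : pred I) (G : I -> H) z :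
  s (\sum_(i <- r | P i) G i) z = \sum_(i <- r | P i) s (G i) z.
Proof. exact: (big_morph (s^~ z) (fun x y => siDl x y z) (si0l z)). Qed.

Lemma si_sumr (I : Type) (r : seq I) (P : pred I) (G : I -> H) z :
  s z (\sum_(i <- r | P i) G i) = \sum_(i <- r | P i) s z (G i).
Proof. exact: (big_morph (s z) (fun x y => siDr x y z) (si0r z)). Qed.

Lemma si_re_conj x y : sc_re (s y x) = sc_re (s x y).
Proof. by rewrite (si_conj sP) sc_re_conj. Qed.

Lemma form_sq_ge0 x : 0 <= N x. Proof. by have [] := sc_ge0P (si_ge0 sP x). Qed.

Lemma form_sqE x : s x x = sc_ofR (N x).
Proof. by rewrite sc_ofR_re// si_ge0. Qed.

Lemma form_sq0 : N 0 = 0. Proof. by rewrite /form_sq si0l sc_re0. Qed.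

Lemma form_sqD x y : N (x + y) = N x + N y + 2 * sc_re (s x y).
Proof. by rewrite /form_sq siDl !siDr !sc_reD (si_re_conj x y); ring. Qed.

Lemma form_sqZ a x : N (a *: x) = sc_nm a ^+ 2 * N x.
Proof.
rewrite /form_sq siZl siZr mulrA sc_mulconj sc_reM sc_im_ofR mul0r subr0.
by rewrite sc_re_ofR.
Qed.

Lemma form_sqN x : N (- x) = N x.
Proof. by rewrite /form_sq siNl siNr opprK. Qed.

Lemma form_sqB x y : N (x - y) = N x + N y - 2 * sc_re (s x y).
Proof. by rewrite form_sqD form_sqN siNr sc_reN; ring. Qed.

Lemma form_sqD_le x y : N (x + y) <= 2 * (N x + N y).
Proof. by have := form_sq_ge0 (x - y); rewrite form_sqB form_sqD; lra. Qed.

Lemma form_cs x y : sc_nm (s x y) ^+ 2 <= N x * N y.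
Proof.
set c := sc_nm (s x y) ^+ 2.
have c0 : 0 <= c by rewrite exprn_ge0 ?sc_nm_ge0.
(* The usual quadratic, from the vector x - t s(x,y) y with t real. *)
have key (t : R) : 0 <= N x - 2 * t * c + t ^+ 2 * c * N y.
  have := form_sq_ge0 (x - (sc_ofR t * s x y) *: y).
  rewrite form_sqB siZr form_sqZ sc_nmM sc_nm_ofR exprMn real_normK ?num_real// -/c.
  rewrite sc_conjM sc_conj_ofR -mulrA (mulrC (sc_conj _)) sc_mulconj -/c.
  rewrite -sc_ofRM sc_re_ofR; lra.
have [y0|y0] := eqVneq (N y) 0; last first.
  have yp : 0 < N y by rewrite lt_neqAle eq_sym y0 form_sq_ge0.
  have := key (N y)^-1.
  have -> : N x - 2 * (N y)^-1 * c + (N y)^-1 ^+ 2 * c * N y = N x - c / N y by field.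
  by rewrite subr_ge0 ler_pdivrMr.
rewrite y0 mulr0; have [//|cp] := leP c 0.
(* When [N y = 0] the quadratic is affine in t with slope -2c; this t gives it the value -1. *)
have := key ((N x + 1) / (2 * c)).
have -> : N x - 2 * ((N x + 1) / (2 * c)) * c + ((N x + 1) / (2 * c)) ^+ 2 * c * N y = -1.
  by rewrite y0; field; rewrite gt_eqF.
lra.
Qed.

Lemma form_sq_null x y : N x = 0 -> s x y = 0.
Proof.
move=> x0; have := form_cs x y; rewrite x0 mul0r => h.
by apply: sc_nm_eq0; apply/eqP; rewrite -sqrf_eq0 eq_le h exprn_ge0// sc_nm_ge0.
Qed.

(* AM-GM on [2 |a| |s(y,x)|], as [|s(y,x)|^2 <= (A B) N(x)]. *)
Lemma form_sq_comb (I : Type) (r : seq I) (a : I -> F) (g : I -> H) :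
  N (\sum_(i <- r) a i *: g i) <=
  (\sum_(i <- r) sc_nm (a i) ^+ 2) * (\sum_(i <- r) N (g i)).
Proof.
elim: r => [|i r ih]; first by rewrite !big_nil form_sq0 mul0r.
rewrite !big_cons addrC; set y := \sum_(j <- r) a j *: g j in ih *.
set A := \sum_(j <- r) _ in ih *; set B := \sum_(j <- r) _ in ih *.
have A0 : 0 <= A by apply: sumr_ge0 => j _; rewrite exprn_ge0// sc_nm_ge0.
have B0 : 0 <= B by apply: sumr_ge0 => j _; exact: form_sq_ge0.
rewrite form_sqD form_sqZ siZr.
have n0 := form_sq_ge0 (g i).
set m := sc_nm (a i).
set P := m ^+ 2 * B; set Q := A * N (g i).
have P0 : 0 <= P by rewrite mulr_ge0// sqr_ge0.
have Q0 : 0 <= Q by rewrite mulr_ge0.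
have re2 : sc_re (sc_conj (a i) * s y (g i)) ^+ 2 <= P * Q.
  apply: (@le_trans _ _ (sc_nm (sc_conj (a i) * s y (g i)) ^+ 2)).
    by rewrite -[X in X <= _]real_normK ?num_real// lerXn2r ?nnegrE ?sc_nm_ge0// sc_re_le_nm.
  rewrite sc_nmM sc_nm_conj exprMn -/m.
  have -> : P * Q = m ^+ 2 * ((A * B) * N (g i)) by rewrite /P /Q; ring.
  rewrite ler_wpM2l ?sqr_ge0//; apply: le_trans (form_cs _ _) _.
  by rewrite ler_wpM2r.
have : 2 * sc_re (sc_conj (a i) * s y (g i)) <= P + Q.
  set v := sc_re _ in re2 *.
  have [v0|v0] := leP v 0; first by nra.
  rewrite -ler_sqr ?nnegrE; [|lra|lra].
  have := sqr_ge0 (P - Q); nra.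
rewrite /P /Q; lra.
Qed.
End Basic.

Section Orthonormal.
Context {H : lmodType F} {s : H -> H -> F} (sP : semi_inner s).
Local Notation N := (form_sq s).

(* Zero vectors are allowed, so that Gram-Schmidt need not discard any index. *)
Definition onz {I : Type} (f : I -> H) : Prop :=
  (forall i j, i <> j -> s (f i) (f j) = 0) /\
  (forall i, f i = 0 \/ s (f i) (f i) = 1).

Definition proj {I : Type} (f : I -> H) (r : seq I) (x : H) : H :=
  \sum_(i <- r) s x (f i) *: f i.

(** Approximation by finite projections stands in for convergence of the Fourier series: it needs no
    order on the index type and no completeness of the form. *)
Definition approximable {I : eqType} (f : I -> H) (x : H) : Prop :=
  forall e : R, 0 < e -> exists2 r : seq I, uniq r & N (x - proj f r x) < e.

Section Family.
Context {I : eqType} {f : I -> H} (fo : onz f).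
Implicit Types (r : seq I) (x y : H).

Lemma onz_mul x i : s x (f i) * s (f i) (f i) = s x (f i).
Proof. by case: fo => _ /(_ i) [->|->]; rewrite ?(si0r sP) ?mul0r ?mulr1. Qed.

Lemma onz_scale i : s (f i) (f i) *: f i = f i.
Proof. by case: fo => _ /(_ i) [->|->]; rewrite ?scaler0 ?scale1r. Qed.

Lemma proj_lin r a x y : proj f r (a *: x + y) = a *: proj f r x + proj f r y.
Proof.
rewrite /proj scaler_sumr -big_split/=; apply: eq_bigr => i _.
by rewrite (si_lin sP) scalerDl scalerA.
Qed.

Lemma projB r x y : proj f r (x - y) = proj f r x - proj f r y.
Proof. by have := proj_lin r (-1) y x; rewrite !scaleN1r addrC => ->; rewrite addrC. Qed.

Lemma si_proj r x i : uniq r -> s (proj f r x) (f i) = if i \in r then s x (f i) else 0.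
Proof.
move=> ur; rewrite (si_suml sP); case: ifP => ir.
  rewrite (bigD1_seq i)//= (siZl sP) onz_mul big1 ?addr0// => j /eqP ji.
  by rewrite (siZl sP) fo.1 ?mulr0.
rewrite big1_seq// => j /= jr; rewrite (siZl sP) fo.1 ?mulr0// => ji.
by rewrite -ji jr in ir.
Qed.

Lemma si_res r x i : uniq r -> i \in r -> s (x - proj f r x) (f i) = 0.
Proof. by move=> ur ir; rewrite (siBl sP) si_proj// ir subrr. Qed.

Lemma si_res_proj r x y : uniq r -> s (x - proj f r x) (proj f r y) = 0.
Proof.
move=> ur; rewrite (si_sumr sP) big1_seq// => i /= ir.
by rewrite (siZr sP) si_res// mulr0.
Qed.

Lemma form_sq_proj r x : uniq r -> N (proj f r x) = \sum_(i <- r) sc_nm (s x (f i)) ^+ 2.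
Proof.
move=> ur; have /eqP := si_res_proj x x ur; rewrite (siBl sP) subr_eq0 => /eqP e.
rewrite /form_sq -e (si_sumr sP) sc_re_sumr; apply: eq_bigr => i _.
by rewrite (siZr sP) mulrC sc_mulconj sc_re_ofR.
Qed.

Lemma form_sq_res r x : uniq r ->
  N (x - proj f r x) = N x - \sum_(i <- r) sc_nm (s x (f i)) ^+ 2.
Proof.
move=> ur; have := form_sqD sP (x - proj f r x) (proj f r x).
by rewrite subrK si_res_proj// sc_re0 form_sq_proj// => ->; ring.
Qed.

Lemma form_sq_res_le r x : uniq r -> N (x - proj f r x) <= N x.
Proof.
move=> ur; rewrite form_sq_res// lerBlDr lerDl; apply: sumr_ge0 => i _.
by rewrite exprn_ge0// sc_nm_ge0.
Qed.

Lemma bessel r x : uniq r -> \sum_(i <- r) sc_nm (s x (f i)) ^+ 2 <= N x.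
Proof. by move=> ur; rewrite -subr_ge0 -form_sq_res// form_sq_ge0. Qed.

Lemma proj_mem r i : uniq r -> i \in r -> proj f r (f i) = f i.
Proof.
move=> ur ir; rewrite /proj (bigD1_seq i)//= onz_scale big1 ?addr0// => j /eqP ji.
by rewrite fo.1 ?scale0r// => /esym.
Qed.

Lemma proj_proj r r' x : uniq r' -> {subset r <= r'} -> proj f r' (proj f r x) = proj f r x.
Proof.
move=> ur' rr'; rewrite {2}/proj [in LHS]/proj.
transitivity (\sum_(i <- r) s x (f i) *: proj f r' (f i)).
  rewrite [RHS](eq_bigr (fun i => \sum_(j <- r') (s x (f i) * s (f i) (f j)) *: f j)).
    rewrite exchange_big/=; apply: eq_bigr => j _.
    rewrite (si_suml sP) scaler_suml; apply: eq_bigr => i _.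
    by rewrite (siZl sP).
  by move=> i _; rewrite /proj scaler_sumr; apply: eq_bigr => j _; rewrite scalerA.
by apply: eq_big_seq => i /rr' ir; rewrite proj_mem.
Qed.

(** The residual of x along r' is also the residual along r' of the vector x - proj r x, and taking
    residuals does not increase the form. *)
Lemma form_sq_res_sub r r' x : uniq r' -> {subset r <= r'} ->
  N (x - proj f r' x) <= N (x - proj f r x).
Proof.
move=> ur' rr'.
have := form_sq_res_le (x - proj f r x) ur'.
by rewrite projB proj_proj// opprB addrA subrK.
Qed.

Lemma approximable0 : approximable f 0.
Proof. by move=> e e0; exists [::] => //; rewrite /proj big_nil subrr form_sq0. Qed.

Lemma approximable_mem i : approximable f (f i).
Proof. by move=> e e0; exists [:: i] => //; rewrite proj_mem ?mem_head// subrr form_sq0. Qed.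

Lemma approximable_lin a x y : approximable f x -> approximable f y ->
  approximable f (a *: x + y).
Proof.
move=> gx gy e e0.
(* Chosen so that 2 (|a|^2 d + d) = e, the factor 2 being that of [form_sqD_le]. *)
pose d := e / (2 * (sc_nm a ^+ 2 + 1)).
have a0 : 0 <= sc_nm a ^+ 2 by exact: sqr_ge0.
have d0 : 0 < d by rewrite divr_gt0// mulr_gt0//; lra.
have [r1 u1 h1] := gx _ d0; have [r2 u2 h2] := gy _ d0.
exists (undup (r1 ++ r2)); first exact: undup_uniq.
set r := undup _; have ur : uniq r by exact: undup_uniq.
rewrite proj_lin opprD addrACA -scalerBr.
have k1 : N (x - proj f r x) < d.
  by apply: le_lt_trans h1; apply: form_sq_res_sub => // i ir; rewrite mem_undup mem_cat ir.
have k2 : N (y - proj f r y) < d.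
  by apply: le_lt_trans h2; apply: form_sq_res_sub => // i ir; rewrite mem_undup mem_cat ir orbT.
apply: le_lt_trans (form_sqD_le sP _ _) _; rewrite (form_sqZ sP).
have -> : e = 2 * (sc_nm a ^+ 2 * d + d).
  by rewrite /d; field; lra.
rewrite ltr_pM2l// ler_ltD// ler_wpM2l// ltW//.
Qed.

Lemma approximable_closed x :
  (forall e : R, 0 < e -> exists2 y, approximable f y & N (x - y) < e) ->
  approximable f x.
Proof.
move=> h e e0; have e4 : 0 < e / 4 by rewrite divr_gt0.
have [y gy xy] := h _ e4; have [r ur yr] := gy _ e4.
exists r => //.
(* The first residual is bounded by [N (x - y)]; each term is below e/4 and [form_sqD_le] doubles
   their sum. *)
have -> : x - proj f r x = ((x - y) - proj f r (x - y)) + (y - proj f r y).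
  by rewrite projB opprB addrACA subrK addrAC subrr add0r.
apply: le_lt_trans (form_sqD_le sP _ _) _.
have := form_sq_res_le (x - y) ur; lra.
Qed.
End Family.

Lemma parseval {I : choiceType} (f : I -> H) (x : H) :
  onz f -> approximable f x ->
  \esum_(i in [set: I]) (sc_nm (s x (f i)) ^+ 2)%:E = (N x)%:E.
Proof.
move=> fo gx; apply/eqP; rewrite eq_le; apply/andP; split.
  apply: ge_ereal_sup => _ [A [finA _] <-].
  by rewrite fsbig_finite//= sumEFin lee_fin bessel.
apply/lee_addgt0Pr => e e0; have [r ur re] := gx _ e0.
apply: (@le_trans _ _ ((\sum_(i <- r) sc_nm (s x (f i)) ^+ 2)%:E + e%:E)%E).
  by rewrite -EFinD lee_fin; move: re; rewrite form_sq_res//; lra.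
rewrite leeD2r//; apply: esum_ge; exists [set` r]; first by split => //; exact: finite_seq.
by rewrite -fsbig_seq// sumEFin.
Qed.

(** * Gram-Schmidt for a semi-inner product *)

Section GramSchmidt.
Variable u : nat -> H.

(** A null residual is sent to 0: for a semi-inner product it may be a non-zero vector, and [onz]
    admits only 0 and unit vectors. *)
Definition gs_step (L : seq H) (v : H) : H :=
  let r := v - \sum_(g <- L) s v g *: g in
  sc_ofR (Num.sqrt (N r))^-1 *: (if N r == 0 then 0 else r).

Fixpoint gs_list (n : nat) : seq H :=
  if n is m.+1 then rcons (gs_list m) (gs_step (gs_list m) (u m)) else [::].

Definition gram_schmidt (n : nat) : H := gs_step (gs_list n) (u n).
Local Notation g := gram_schmidt.

Lemma gs_listE n : gs_list n = [seq g i | i <- iota 0 n].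
Proof. by elim: n => // n ih; rewrite -[n.+1]addn1 iotaD map_cat addn1 /= cats1 -ih. Qed.

Lemma gram_schmidtE n : let r := u n - proj g (iota 0 n) (u n) in
  g n = sc_ofR (Num.sqrt (N r))^-1 *: (if N r == 0 then 0 else r).
Proof. by rewrite /g /gs_step gs_listE big_map. Qed.

Lemma gram_schmidt_onz : onz g.
Proof.
have unit n : g n = 0 \/ s (g n) (g n) = 1.
  have := gram_schmidtE n => /=; set r := u n - _; have [e ->|r0 ->] := eqVneq (N r) 0.
    by left; rewrite scaler0.
  right; rewrite (siZl sP) (siZr sP) sc_conj_ofR (form_sqE sP) -!sc_ofRM -sc_ofR1.
  have rp : 0 < N r by rewrite lt_neqAle eq_sym r0 form_sq_ge0.
  congr sc_ofR; rewrite mulrA -invfM -expr2 sqr_sqrtr ?(form_sq_ge0 sP)//.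
  by rewrite mulVf.
have orth n : forall i j, (i < n)%N -> (j < n)%N -> i <> j -> s (g i) (g j) = 0.
  elim: n => // n ih.
  (* The projection lemmas ask for a family that is orthonormal at all indices; padding with zeros
     from n on gives one by the induction hypothesis, with the same projection of [u n]. *)
  pose g' i := if (i < n)%N then g i else 0.
  have g'o : onz g'.
    split=> [i j ij|i]; rewrite /g'; last by case: ifP => _; [exact: unit|left].
    case: ifP => i1; last by rewrite (si0l sP).
    by case: ifP => j1; [exact: ih|rewrite (si0r sP)].
  have new j : (j < n)%N -> s (g n) (g j) = 0.
    move=> jn; rewrite gram_schmidtE (siZl sP); case: ifP => _; first by rewrite (si0l sP) mulr0.
    have -> : proj g (iota 0 n) (u n) = proj g' (iota 0 n) (u n).
      by apply: eq_big_seq => i; rewrite mem_iota /= /g' add0n => ->.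
    have -> : g j = g' j by rewrite /g' jn.
    by rewrite (si_res g'o) ?mulr0 ?iota_uniq// mem_iota.
  move=> i j; rewrite !ltnS (leq_eqVlt i) (leq_eqVlt j) => /orP[/eqP->|i1] /orP[/eqP->|j1] ij //.
  - exact: new.
  - by rewrite (si_conj sP) new// sc_conj0.
  - exact: ih.
split=> // i j ij; apply: (orth (maxn i j).+1) => //; rewrite ltnS ?leq_maxl ?leq_maxr//.
Qed.

(** Only the form of the residual vanishes: [u n] may differ from its projection by a null vector.
    For a Hilbert inner product this means that [u n] lies in the span of the new family. *)
Lemma gram_schmidt_res n :
  N (u n - proj g (iota 0 n.+1) (u n)) = 0.
Proof.
have go := gram_schmidt_onz.
set r := u n - proj g (iota 0 n) (u n).
have E : u n - proj g (iota 0 n.+1) (u n) = r - proj g (iota 0 n.+1) r.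
  rewrite projB proj_proj ?iota_uniq// => [|i]; last by rewrite !mem_iota /= !add0n => /ltnW.
  by rewrite /r opprB addrA subrK.
rewrite E; have uq := iota_uniq 0 n.+1.
have nq : n \in iota 0 n.+1 by rewrite mem_iota /= add0n.
move: (iota 0 n.+1) uq nq => q uq nq {E}.
have := gram_schmidtE n; rewrite -/r /=; case: eqVneq => [r0 _|r0 gE].
  by apply/eqP; rewrite eq_le (form_sq_ge0 sP) andbT -[X in _ <= X]r0 (form_sq_res_le go).
have rE : r = sc_ofR (Num.sqrt (N r)) *: g n + 0.
  rewrite gE scalerA -sc_ofRM mulfV ?sc_ofR1 ?scale1r ?addr0//.
  by rewrite sqrtr_eq0 -ltNge lt_neqAle eq_sym r0 form_sq_ge0.
rewrite rE proj_lin proj_mem//.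
by rewrite /proj big1 ?subrr ?form_sq0// => i _; rewrite (si0l sP) scale0r.
Qed.

Lemma gram_schmidt_mem (P : set H) : P 0 ->
  (forall a x y, P x -> P y -> P (a *: x + y)) ->
  (forall n, P (u n)) -> forall n, P (g n).
Proof.
move=> P0 Plin Pu n; suff : forall i, (i < n.+1)%N -> P (g i) by apply.
elim: n.+1 => // m ih i; rewrite ltnS leq_eqVlt => /orP[/eqP->|/ih //].
rewrite gram_schmidtE; have PZ a x : P x -> P (a *: x) by move=> /Plin/(_ P0); rewrite -[a *: x]addr0.
apply: (PZ); case: ifP => // _; rewrite -scaleN1r addrC; apply: (Plin) => //.
rewrite /proj big_seq; elim/big_rec: _ => // j x; rewrite mem_iota /= add0n => /ih gj Px.
exact: Plin.
Qed.
End GramSchmidt.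
End Orthonormal.
End Forms.
Arguments onz {R k H} s {I} f.
Arguments proj {R k H} s {I} f r x.
Arguments approximable {R k H} s {I} f x.
Arguments gram_schmidt {R k H} s u n.

(** * Hilbert spaces, total families and the Riesz representation *)

Section HilbertBasics.
Context {R : realType} {k : scalar_kind}.
Local Notation F := (scalarField R k).

Section Norms.
Context {H : hilbertType R k}.
Implicit Types (x y z : H).

Definition hsq (x : H) : R := form_sq inner x.

Lemma inner_semi : semi_inner (inner : H -> H -> F).
Proof.
split=> [a x y z|x y|x]; [exact: innerP|exact: inner_conj|].
by rewrite inner_norm exprn_ge0.
Qed.

Lemma hsqE x : hsq x = sc_re `|x| ^+ 2.
Proof.
rewrite /hsq /form_sq inner_norm -(@sc_ofR_re _ _ `|x|)//.
by rewrite -sc_ofRX !sc_re_ofR.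
Qed.

Lemma hsq_ge0 x : 0 <= hsq x. Proof. exact: form_sq_ge0 inner_semi _. Qed.

Lemma inner_hsq x : inner x x = sc_ofR (hsq x). Proof. exact: form_sqE inner_semi _. Qed.

Lemma hsqN x : hsq (- x) = hsq x. Proof. exact: form_sqN inner_semi _. Qed.

Lemma hsqBC x y : hsq (x - y) = hsq (y - x). Proof. by rewrite -hsqN opprB. Qed.

Lemma hsqZ a x : hsq (a *: x) = sc_nm a ^+ 2 * hsq x. Proof. exact: form_sqZ inner_semi _ _. Qed.

Lemma hsq0 : hsq 0 = 0. Proof. exact: form_sq0 inner_semi. Qed.

Lemma hsqD_le x y : hsq (x + y) <= 2 * (hsq x + hsq y).
Proof. exact: form_sqD_le inner_semi _ _. Qed.

Lemma norm_ofR x : `|x| = sc_ofR (Num.sqrt (hsq x)).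
Proof. by rewrite hsqE sqrtr_sqr ger0_norm ?sc_ofR_re//; have [] := sc_ge0P (normr_ge0 x). Qed.

Lemma hsq_eq0 x : hsq x = 0 -> x = 0.
Proof. by move=> x0; apply/eqP; rewrite -normr_eq0 norm_ofR x0 sqrtr0 sc_ofR0. Qed.

Lemma norm_lt_hsq x (e : F) : 0 < e -> (`|x| < e) = (hsq x < sc_re e ^+ 2).
Proof.
move=> e0; rewrite norm_ofR -(sc_ofR_re (ltW e0)) sc_ofR_lt sc_re_ofR.
have p0 : 0 <= sc_re e by have [] := sc_ge0P (ltW e0).
by rewrite -[in RHS](sqr_sqrtr (hsq_ge0 x)) ltr_sqr ?nnegrE ?sqrtr_ge0.
Qed.

Lemma inner_cs x y : sc_nm (inner x y) ^+ 2 <= hsq x * hsq y.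
Proof. exact: form_cs inner_semi _ _. Qed.

Lemma inner_ext x y : (forall z, inner x z = inner y z) -> x = y.
Proof.
move=> h; apply/eqP; rewrite -subr_eq0; apply/eqP/hsq_eq0.
by rewrite /hsq /form_sq innerDl innerNl h subrr sc_re0.
Qed.

Definition hsq_cvg (u : nat -> H) (l : H) : Prop :=
  forall e : R, 0 < e -> exists N, forall n, (N <= n)%N -> hsq (l - u n) < e.

Lemma hsq_complete (u : nat -> H) :
  (forall e : R, 0 < e -> exists N, forall m n, (N <= m)%N -> (N <= n)%N ->
     hsq (u m - u n) < e) ->
  exists l : H, hsq_cvg u l.
Proof.
move=> cu.
have /cvg_ex[l ul] : cvg (u @ \oo).
  apply/cauchy_cvgP; apply: cauchy_exP => e e0.
  have p0 := sc_re_gt0 e0.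
  have [N uN] := cu _ (exprn_gt0 2 p0); exists (u N).
  by exists N => // n /= Nn; rewrite -ball_normE /ball_ /= norm_lt_hsq// uN.
exists l => e e0.
have e1 : 0 < sc_ofR (Num.sqrt e) :> F by rewrite sc_ofR_gt0 ?sqrtr_gt0.
have /cvgrPdist_lt/(_ _ e1)[N _ uN] := ul.
exists N => n Nn; have := uN n Nn; rewrite norm_lt_hsq// sc_re_ofR sqr_sqrtr//.
exact: ltW.
Qed.

Lemma dense_hsq (A : set H) : dense A <->
  forall x (e : R), 0 < e -> exists2 a, A a & hsq (x - a) < e.
Proof.
split=> [dA x e e0|h O [x Ox] oO].
  have e1 : 0 < sc_ofR (Num.sqrt e) :> F by rewrite sc_ofR_gt0 ?sqrtr_gt0.
  have [|a [xa Aa]] := dA ((ball x (sc_ofR (Num.sqrt e) : F))^°) _ (@open_interior _ _).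
    by exists x; exact: nbhs_singleton (nbhs_interior (nbhsx_ballx _ _ e1)).
  exists a => //; have := interior_subset xa.
  by rewrite -ball_normE /ball_ /= norm_lt_hsq// sc_re_ofR sqr_sqrtr// ltW.
have /nbhs_ballP[e /= e0 xe] : nbhs x O by exact: open_nbhs_nbhs.
have p0 := sc_re_gt0 e0.
have [a Aa xa] := h x _ (exprn_gt0 2 p0).
by exists a; split => //; apply: xe; rewrite -ball_normE /ball_ /= norm_lt_hsq.
Qed.
End Norms.

(** * Closed subspaces and total families *)

Section Total.
Context {H : hilbertType R k}.
Implicit Types (A E P : set H) (x y z : H).

Definition closed_subspace P : Prop :=
  [/\ P 0, forall a x y, P x -> P y -> P (a *: x + y) &
   forall x, (forall e : R, 0 < e -> exists2 y, P y & hsq (x - y) < e) -> P x].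

(** The closed linear span of A is the whole space, put as an induction principle: a property that
    defines a closed subspace need only be checked on A. *)
Definition total A : Prop :=
  forall P, closed_subspace P -> A `<=` P -> forall x, P x.

Lemma dense_total A : dense A -> total A.
Proof.
move=> /dense_hsq dA P [_ _ cP] AP x; apply: cP => e e0.
by have [a /AP Pa xa] := dA x e e0; exists a.
Qed.

Lemma subspace_sum P (I : Type) (r : seq I) (c : I -> F) (g : I -> H) :
  closed_subspace P -> (forall i, P (g i)) -> P (\sum_(i <- r) c i *: g i).
Proof.
by move=> [P0 PD _] Pg; elim/big_rec: _ => // i x _ Px; exact: PD.
Qed.

Lemma lin_span_dense_total E : dense (lin_span E) -> total E.
Proof.
move=> dE P cP EP; apply: (dense_total dE) => // _ [n [c [e [eE ->]]]].
by apply: subspace_sum => // i; exact/EP/eE.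
Qed.

Lemma lin_span_lin E a x y : lin_span E x -> lin_span E y -> lin_span E (a *: x + y).
Proof.
move=> [n [c [e [eE ->]]]] [m [d [f [fE ->]]]].
exists (n + m)%N, (fun i => match fintype.split i with inl j => a * c j | inr j => d j end),
  (fun i => match fintype.split i with inl j => e j | inr j => f j end); split.
  by move=> i; case: (fintype.split i).
rewrite big_split_ord/= scaler_sumr; congr (_ + _); apply: eq_bigr => i _.
  by case: split_ordP => j => [/lshift_inj <-|/eqP]; rewrite ?scalerA// eq_lrshift.
by case: split_ordP => j => [/eqP|/rshift_inj <-//]; rewrite eq_rlshift.
Qed.

Lemma total_lin_span_dense E : total E -> dense (lin_span E).
Proof.
move=> tE; apply/dense_hsq.
(* The closure of the span is itself a closed subspace containing E, so totality applies to it. *)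
suff: forall x, (fun x => forall e : R, 0 < e -> exists2 a, lin_span E a & hsq (x - a) < e) x by [].
apply: tE; first split.
- move=> e e0; exists 0; last by rewrite subrr hsq0.
  by exists 0, (fun=> 0), (fun=> 0); split => [[]//|]; rewrite big_ord0.
- move=> a x y hx hy e e0.
  pose d := e / (2 * (sc_nm a ^+ 2 + 1)).
  have a0 : 0 <= sc_nm a ^+ 2 by exact: sqr_ge0.
  have d0 : 0 < d by rewrite divr_gt0// mulr_gt0//; lra.
  have [u uE xu] := hx _ d0; have [v vE yv] := hy _ d0.
  exists (a *: u + v); first exact: lin_span_lin.
  rewrite opprD addrACA -scalerBr.
  apply: le_lt_trans (hsqD_le _ _) _; rewrite hsqZ.
  have -> : e = 2 * (sc_nm a ^+ 2 * d + d) by rewrite /d; field; lra.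
  by rewrite ltr_pM2l// ler_ltD// ler_wpM2l// ltW.
- move=> x h e e0; have e4 : 0 < e / 4 by rewrite divr_gt0.
  have [y hy xy] := h _ e4; have [a aE ya] := hy _ e4; exists a => //.
  have -> : x - a = (x - y) + (y - a) by rewrite addrA subrK.
  by apply: le_lt_trans (hsqD_le _ _) _; lra.
- move=> x Ex e e0; exists x; last by rewrite subrr hsq0.
  exists 1%N, (fun=> 1), (fun=> x); split => //.
  by rewrite big_ord1 scale1r.
Qed.

Lemma separable_seq : separable H -> exists u : nat -> H, dense (range u).
Proof.
move=> [A /countable_injP[f fi] dA].
(* Integers that code no element of A are sent to 0, which at most enlarges the range. *)
pose u n := xget 0 [set a | A a /\ f a = n].
exists u; apply/dense_hsq => x e e0.
have [a Aa xa] := (dense_hsq A).1 dA x e e0.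
exists a => //; exists (f a) => //; rewrite /u.
case: xgetP => [b _ [Ab]|/(_ a)]; last by case.
by move=> /fi; rewrite !inE; apply.
Qed.

(* [theta] is the identity or the conjugation. *)
Lemma ker_closed_subspace (theta : F -> F) (D : H -> F) (C : R) :
  (forall a x y, D (a *: x + y) = theta a * D x + D y) ->
  (forall x, sc_nm (D x) ^+ 2 <= C * hsq x) ->
  closed_subspace [set x | D x = 0].
Proof.
move=> Dl DC; have D0 : D 0 = 0.
  have := DC 0; rewrite hsq0 mulr0 => h; apply: sc_nm_eq0; apply/eqP.
  by rewrite -sqrf_eq0 eq_le h sqr_ge0.
split=> //= [a x y x0 y0|x h]; first by rewrite Dl x0 y0 mulr0 addr0.
apply: sc_nm_eq0; apply/eqP; rewrite -sqrf_eq0 eq_le sqr_ge0 andbT.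
apply/ler_addgt0Pl => e e0; rewrite addr0.
have C1 : 0 < `|C| + 1 by rewrite ltr_wpDl.
have [y /= y0 xy] := h _ (divr_gt0 e0 C1).
have -> : D x = D (x - y).
  have := Dl 1 (x - y) y; rewrite scale1r subrK => ->; rewrite y0 addr0.
  have := Dl 1 y 0; have := Dl 1 (x - y) 0; rewrite !scale1r !addr0 D0 addr0 => E _.
  by rewrite -E.
apply: le_trans (DC _) _.
apply: (@le_trans _ _ ((`|C| + 1) * (e / (`|C| + 1)))); last by rewrite mulrC divfK// gt_eqF.
apply: (@le_trans _ _ ((`|C| + 1) * hsq (x - y))).
  by rewrite ler_wpM2r ?hsq_ge0// (le_trans (ler_norm _))// lerDl.
by rewrite ler_wpM2l ?ltW.
Qed.

(** The bound C does not depend on n, so replacing x by a nearby y changes all the [D n x] by at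
    most e/4 at once; the Cauchy property passes from y to x. *)
Lemma cvg_closed_subspace (theta : F -> F) (D : nat -> H -> F) (C : R) :
  (forall n a x y, D n (a *: x + y) = theta a * D n x + D n y) ->
  (forall n x, sc_nm (D n x) ^+ 2 <= C * hsq x) ->
  closed_subspace [set x | exists l : F, (fun n => D n x) @ \oo --> l].
Proof.
move=> Dl DC; have D0 n : D n 0 = 0.
  have := DC n 0; rewrite hsq0 mulr0 => h; apply: sc_nm_eq0; apply/eqP.
  by rewrite -sqrf_eq0 eq_le h sqr_ge0.
split=> /= [|a x y [l xl] [m ym]|x h].
- by exists 0; under eq_fun do rewrite D0; exact: cvg_cst.
- exists (theta a * l + m); under eq_fun do rewrite Dl.
  by apply: cvgD => //; apply: cvgM => //; exact: cvg_cst.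
have C1 : 0 < `|C| + 1 by rewrite ltr_wpDl.
apply: sc_cauchy => e e0; have e4 : 0 < e / 4 by rewrite divr_gt0.
have [y /= [l ly] xy] := h _ (divr_gt0 (exprn_gt0 2 e4) C1).
move/sc_cvgP: ly => /(_ _ e4)[N _ yl].
have DB n : D n x - D n y = D n (x - y).
  have := Dl n 1 (x - y) y; have := Dl n 1 (x - y) 0.
  by rewrite !scale1r addr0 D0 addr0 subrK => <- ->; rewrite addrK.
have xyn n : sc_nm (D n x - D n y) <= e / 4.
  rewrite DB -ler_sqr ?nnegrE; [|exact: sc_nm_ge0|exact: ltW].
  apply: le_trans (DC _ _) _.
  apply: (@le_trans _ _ ((`|C| + 1) * ((e / 4) ^+ 2 / (`|C| + 1)))).
    apply: (@le_trans _ _ ((`|C| + 1) * hsq (x - y))).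
      by rewrite ler_wpM2r ?hsq_ge0// (le_trans (ler_norm _))// lerDl.
    by rewrite ler_wpM2l ?ltW.
  by rewrite mulrC divfK// gt_eqF.
exists N => m n Nm Nn.
have -> : D m x - D n x = (D m x - D m y) + ((D m y - l) + ((l - D n y) + (D n y - D n x))).
  by ring.
apply: le_lt_trans (sc_nmD _ _) _.
have := le_trans (sc_nmD _ _) (lerD (lexx (sc_nm (D m y - l))) (sc_nmD (l - D n y) (D n y - D n x))).
have := xyn m; have := xyn n; have := yl m Nm; have := yl n Nn.
rewrite /= -(sc_nmN (D n y - l)) -(sc_nmN (D n x - D n y)) !opprB.
lra.
Qed.
End Total.
End HilbertBasics.

(** * Orthonormal expansions, the Riesz representation, operators given by a matrix *)

Section Bases.
Context {R : realType} {k : scalar_kind}.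
Local Notation F := (scalarField R k).

Section Families.
Context {H : hilbertType R k}.
Implicit Types (x y z : H).
Local Notation ionz := (@onz R k H inner _).
Local Notation iapprox := (@approximable R k H inner _).
Local Notation igs := (@gram_schmidt R k H inner).

Lemma approximable_closed_subspace {I : eqType} (f : I -> H) : ionz f ->
  closed_subspace (iapprox f).
Proof.
move=> fo; have sP := @inner_semi R k H; split.
- exact: approximable0.
- by move=> a x y; exact: approximable_lin.
- by move=> x h; exact: approximable_closed.
Qed.

Lemma total_approximable {I : eqType} (f : I -> H) x : ionz f -> total (range f) ->
  iapprox f x.
Proof.
move=> fo; apply; first exact: approximable_closed_subspace.
by move=> _ [i _ <-]; apply: approximable_mem => //; exact: inner_semi.
Qed.

Lemma total_parseval {I : choiceType} (f : I -> H) x : ionz f -> total (range f) ->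
  \esum_(i in [set: I]) (sc_nm (inner x (f i)) ^+ 2)%:E = (hsq x)%:E.
Proof.
by move=> fo tf; apply: parseval => //; [exact: inner_semi|exact: total_approximable].
Qed.

Lemma gram_schmidt_total (u : nat -> H) : total (range u) ->
  total (range (igs u)).
Proof.
have sP := @inner_semi R k H; move=> tu P cP gP; apply: tu => // _ [n _ <-].
have /hsq_eq0/eqP := gram_schmidt_res sP u n; rewrite subr_eq0 => /eqP ->.
by apply: subspace_sum => // i; apply: gP; exists i.
Qed.

Lemma onz_comb (e : nat -> H) (c : nat -> F) (r : seq nat) j : ionz e -> uniq r -> j \in r ->
  inner (\sum_(i <- r) c i *: e i) (e j) = c j * inner (e j) (e j).
Proof.
have sP := @inner_semi R k H; move=> eo ur jr.
rewrite (si_suml sP) (bigD1_seq j)//= innerZl big1 ?addr0// => i /eqP ij.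
by rewrite innerZl eo.1 ?mulr0.
Qed.

Lemma onz_comb_hsq (e : nat -> H) (c : nat -> F) (r : seq nat) : ionz e -> uniq r ->
  hsq (\sum_(i <- r) c i *: e i) <= \sum_(i <- r) sc_nm (c i) ^+ 2.
Proof.
have sP := @inner_semi R k H; move=> eo ur; rewrite /hsq /form_sq (si_sumr sP) sc_re_sumr.
rewrite big_seq [leRHS]big_seq; apply: ler_sum => j jr.
rewrite (siZr sP) onz_comb// mulrA (mulrC (sc_conj _)) sc_mulconj.
have [->|->] := eo.2 j; rewrite ?mulr1 ?sc_re_ofR// inner0l mulr0 sc_re0 sqr_ge0//.
Qed.

Lemma series_hsq_cvg (e : nat -> H) (c : nat -> F) (C : R) : ionz e ->
  (forall n, \sum_(0 <= i < n) sc_nm (c i) ^+ 2 <= C) ->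
  exists w, hsq_cvg (fun n => \sum_(0 <= i < n) c i *: e i) w.
Proof.
move=> eo cC; apply: hsq_complete => d d0.
set S := fun n => \sum_(0 <= i < n) sc_nm (c i) ^+ 2.
have ndS : nondecreasing_seq S.
  move=> m n mn; rewrite /S (big_cat_nat (leq0n m) mn) /= lerDl.
  by apply: sumr_ge0 => i _; exact: sqr_ge0.
have /cvg_cauchy/cauchyP Sc : cvg (S @ \oo).
  by apply: nondecreasing_is_cvgn => //; exists C => _ [n _ <-]; exact: cC.
have [a [N _ Na]] := Sc _ (divr_gt0 d0 (ltr0n _ 2)).
exists N => m n Nm Nn; wlog mn : m n Nm Nn / (n <= m)%N => [h|].
  by have [/h|/ltnW/h] := leqP n m; [exact|rewrite hsqBC; exact].
rewrite (big_cat_nat (leq0n n) mn) /= addrAC subrr add0r.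
apply: le_lt_trans (onz_comb_hsq _ eo (iota_uniq _ _)) _.
have -> : \sum_(n <= i < m) sc_nm (c i) ^+ 2 = S m - S n.
  by rewrite /S (big_cat_nat (leq0n n) mn) /= addrAC subrr add0r.
have := Na m Nm; have := Na n Nn; rewrite /ball /= /ball_ /= !ltr_norml => /andP[? ?] /andP[? ?].
lra.
Qed.

Lemma hsq_cvg_inner (u : nat -> H) (l z : H) (a : F) N : hsq_cvg u l ->
  (forall n, (N <= n)%N -> inner (u n) z = a) -> inner l z = a.
Proof.
move=> ul uN; apply/eqP; rewrite -subr_eq0; apply/eqP; apply: sc_nm_eq0.
apply/eqP; rewrite -sqrf_eq0 eq_le sqr_ge0 andbT.
apply/ler_addgt0Pl => e e0; rewrite addr0.
have z1 : 0 < hsq z + 1 by rewrite ltr_wpDl// hsq_ge0.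
have [M hM] := ul _ (divr_gt0 e0 z1).
have := hM _ (leq_maxr N M); have := uN _ (leq_maxl N M) => <- h.
rewrite -(siBl (@inner_semi _ _ _)); apply: le_trans (inner_cs _ _) _.
apply: (@le_trans _ _ (e / (hsq z + 1) * (hsq z + 1))); last by rewrite divfK// gt_eqF.
by rewrite ler_pM ?hsq_ge0// ?ltW// ltrDl.
Qed.

(** By Bessel and completeness the Fourier series of x has a sum p. As x - p is orthogonal to every
    [e n], it is 0, and x is a limit of combinations of the family. *)
Lemma orthocomplement_total (e : nat -> H) : ionz e ->
  (forall x, (forall n, inner x (e n) = 0) -> x = 0) -> total (range e).
Proof.
have sP := @inner_semi R k H; move=> eo e0 P cP eP x.
have [p pP] : exists w, hsq_cvg (fun n => \sum_(0 <= i < n) inner x (e i) *: e i) w.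
  by apply: (series_hsq_cvg (C := hsq x)) => // n; exact: (bessel sP eo _ (iota_uniq _ _)).
suff -> : x = p.
  case: (cP) => _ _; apply => d d0; have [N hN] := pP _ d0.
  exists (\sum_(0 <= i < N) inner x (e i) *: e i); last exact: hN.
  by apply: subspace_sum => // i; apply: eP; exists i.
apply/eqP; rewrite -subr_eq0; apply/eqP/e0 => n.
rewrite (siBl sP); apply/eqP; rewrite subr_eq0; apply/eqP/esym.
apply: (hsq_cvg_inner (N := n.+1) pP) => m nm.
by rewrite onz_comb ?onz_mul ?iota_uniq// mem_index_iota.
Qed.

(** The vector representing q(x, .) is the sum of the series with coefficients [q x (e i)]; the
    bound on q, tested on the partial sums, makes these coefficients square-summable. *)
Lemma riesz_form (e : nat -> H) (q : H -> H -> F) (C : R) :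
  ionz e -> total (range e) -> 0 <= C ->
  (forall a x y z, q (a *: x + y) z = a * q x z + q y z) ->
  (forall a x y z, q z (a *: x + y) = sc_conj a * q z x + q z y) ->
  (forall x y, sc_nm (q x y) ^+ 2 <= C * hsq x * hsq y) ->
  exists T : H -> H, [/\ linear T, forall x y, inner (T x) y = q x y &
    forall x, hsq (T x) <= C * hsq x].
Proof.
have sP := @inner_semi R k H; move=> eo te C0 ql qr qC.
have q0 x : q x 0 = 0.
  apply: sc_nm_eq0; apply/eqP; rewrite -sqrf_eq0 eq_le sqr_ge0 andbT.
  by apply: le_trans (qC _ _) _; rewrite hsq0 mulr0.
have qZ a x z : q z (a *: x) = sc_conj a * q z x.
  by have := qr a x 0 z; rewrite !addr0 q0 addr0.
have qsum x (c : nat -> F) r : q x (\sum_(i <- r) c i *: e i) = \sum_(i <- r) sc_conj (c i) * q x (e i).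
  elim: r => [|i r ih]; first by rewrite !big_nil q0.
  by rewrite !big_cons qr ih.
(* Both estimates below bound the square of a quantity by a multiple of itself: the partial sum S,
   and then |T x|^2. *)
have le_of (a b : R) : 0 <= a -> 0 <= b -> a ^+ 2 <= b * a -> a <= b.
  move=> a0 b0 ab; have [->//|an] := eqVneq a 0.
  by rewrite -(@ler_pM2r _ a) -?expr2// lt_neqAle eq_sym an.
have ex x : exists w, forall y, inner w y = q x y.
  pose c i := q x (e i).
  have [w wP] : exists w, hsq_cvg (fun n => \sum_(0 <= i < n) c i *: e i) w.
    apply: (series_hsq_cvg (C := C * hsq x)) => // n.
    set S := \sum_(0 <= i < n) _.
    have S0 : 0 <= S by apply: sumr_ge0 => i _; exact: sqr_ge0.
    apply: le_of => //; first by rewrite mulr_ge0// hsq_ge0.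
    have -> : S ^+ 2 = sc_nm (q x (\sum_(0 <= i < n) c i *: e i)) ^+ 2.
      rewrite qsum (eq_bigr (fun i => sc_ofR (sc_nm (c i) ^+ 2))); last first.
        by move=> i _; rewrite mulrC sc_mulconj.
      by rewrite -(big_morph _ (@sc_ofRD R k) (@sc_ofR0 R k)) sc_nm_ofR ger0_norm.
    apply: le_trans (qC _ _) _; rewrite ler_wpM2l ?mulr_ge0 ?hsq_ge0//.
    by apply: onz_comb_hsq => //; exact: iota_uniq.
  exists w => y.
  suff : [set y | inner w y - q x y = 0] y by move=> /= /eqP; rewrite subr_eq0 => /eqP.
  apply: te; last first.
    move=> _ [n _ <-] /=.
    rewrite (hsq_cvg_inner (a := c n * inner (e n) (e n)) (N := n.+1) wP); last first.
      by move=> m nm; rewrite onz_comb ?iota_uniq// mem_index_iota.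
    by rewrite /c; have [->|->] := eo.2 n; rewrite ?q0 ?mul0r ?mulr1 subrr.
  (* The constant is that of (a + b)^2 <= 2 (a^2 + b^2) for the two functionals. *)
  apply: (ker_closed_subspace (theta := sc_conj) (C := 2 * (hsq w + C * hsq x))).
    by move=> a u v; rewrite (siDr sP) (siZr sP) qr; ring.
  move=> u; apply: (@le_trans _ _ ((sc_nm (inner w u) + sc_nm (q x u)) ^+ 2)).
    by rewrite lerXn2r ?nnegrE ?addr_ge0 ?sc_nm_ge0// -(sc_nmN (q x u)) sc_nmD.
  have := inner_cs w u; have := qC x u.
  have := sqr_ge0 (sc_nm (inner w u) - sc_nm (q x u)); lra.
pose T x := projT1 (cid (ex x)).
have TP x y : inner (T x) y = q x y by rewrite /T; case: cid.
exists T; split => //.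
  by move=> a x y; apply: inner_ext => z; rewrite innerP !TP ql.
move=> x; apply: le_of; rewrite ?mulr_ge0 ?hsq_ge0//.
apply: le_trans (qC x (T x)); rewrite -TP inner_hsq sc_nm_ofR ger0_norm// hsq_ge0//.
Qed.

(** The truncations [q n] are semi-inner products with form at most M |x|^2, so Cauchy-Schwarz
    bounds them uniformly in n. On pairs of basis vectors they are eventually constant; hence they
    converge everywhere, and Riesz represents the limit. *)
Lemma matrix_operator (e : nat -> H) (t : nat -> nat -> F) (M : R) :
  ionz e -> total (range e) -> 0 <= M ->
  (forall a b, t b a = sc_conj (t a b)) ->
  (forall a b, e a = 0 -> t a b = 0) ->
  (forall n (c : nat -> F),
     0 <= \sum_(0 <= a < n) \sum_(0 <= b < n) c a * sc_conj (c b) * t a b) ->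
  (forall n (c : nat -> F),
     sc_re (\sum_(0 <= a < n) \sum_(0 <= b < n) c a * sc_conj (c b) * t a b) <=
     M * \sum_(0 <= a < n) sc_nm (c a) ^+ 2) ->
  exists T : H -> H, [/\ linear T, nonneg_operator T,
    forall a b, inner (T (e a)) (e b) = t a b &
    forall x, hsq (T x) <= M ^+ 2 * hsq x].
Proof.
have sP := @inner_semi R k H; move=> eo te M0 tC t0 tge tle.
pose q n x y := \sum_(0 <= a < n) \sum_(0 <= b < n) inner x (e a) * sc_conj (inner y (e b)) * t a b.
have qP n : semi_inner (q n).
  split=> [a x y z|x y|x]; last exact: tge.
    rewrite /q mulr_sumr -big_split/=; apply: eq_bigr => i _.
    rewrite mulr_sumr -big_split/=; apply: eq_bigr => j _.
    by rewrite innerP; ring.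
  rewrite /q sc_conj_sum exchange_big/=; apply: eq_bigr => i _.
  rewrite sc_conj_sum; apply: eq_bigr => j _.
  by rewrite !sc_conjM sc_conjK -tC; ring.
have qle n x : form_sq (q n) x <= M * hsq x.
  apply: le_trans (tle _ _) _; rewrite ler_wpM2l//.
  exact: (bessel sP eo _ (iota_uniq _ _)).
have qcs n x y : sc_nm (q n x y) ^+ 2 <= M ^+ 2 * hsq x * hsq y.
  apply: le_trans (form_cs (qP n) _ _) _.
  have -> : M ^+ 2 * hsq x * hsq y = (M * hsq x) * (M * hsq y) by ring.
  by apply: ler_pM; rewrite ?(form_sq_ge0 (qP n)).
have qe a b n : (maxn a b < n)%N -> q n (e a) (e b) = t a b.
  rewrite gtn_max => /andP[an bn]; rewrite /q (bigD1_seq a) ?iota_uniq ?mem_index_iota//=.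
  rewrite (bigD1_seq b) ?iota_uniq ?mem_index_iota//= !big1 ?addr0; last 2 first.
  - move=> i /eqP ia; rewrite big1// => j _; rewrite eo.1 ?mul0r//; exact/nesym.
  - by move=> j /eqP jb; rewrite (eo.1 b j) ?sc_conj0 ?mulr0 ?mul0r//; exact/nesym.
  (* At a zero basis vector the truncated form vanishes, so the matrix entry has to vanish as
     well. *)
  have [ea|->] := eo.2 a; first by rewrite t0 ?mulr0.
  have [eb|->] := eo.2 b; first by rewrite tC (t0 _ a eb) sc_conj0 mulr0.
  by rewrite sc_conj1 !mul1r.
have ce a b : (fun n => q n (e a) (e b)) @ \oo --> t a b.
  apply: (@cvg_trans _ ((fun=> t a b) @ \oo)); last exact: cvg_cst.
  by apply: near_eq_cvg; exists (maxn a b).+1 => // n /= abn; rewrite qe.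
have ex x y : exists l : F, (fun n => q n x y) @ \oo --> l.
  (* Totality is used twice: in the left variable against a basis vector, then in the right
     variable. *)
  have h b : [set x | exists l : F, (fun n => q n x (e b)) @ \oo --> l] x.
    apply: te; last by move=> _ [a _ <-]; exists (t a b); exact: ce.
    apply: (cvg_closed_subspace (theta := id) (C := M ^+ 2 * hsq (e b))).
      by move=> n c u v; rewrite (si_lin (qP n)).
    by move=> n u; apply: le_trans (qcs _ _ _) _; rewrite mulrAC.
  suff : [set y | exists l : F, (fun n => q n x y) @ \oo --> l] y by [].
  apply: te; last by move=> _ [b _ <-]; exact: h.
  apply: (cvg_closed_subspace (theta := sc_conj) (C := M ^+ 2 * hsq x)).
    by move=> n c u v; rewrite (siDr (qP n)) (siZr (qP n)).
  by move=> n u; exact: qcs.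
pose Q x y := projT1 (cid (ex x y)).
have QP x y : (fun n => q n x y) @ \oo --> Q x y by rewrite /Q; case: cid.
have Qu x y (l : F) : (fun n => q n x y) @ \oo --> l -> Q x y = l.
  exact: sc_cvg_unique.
have [T [Tlin TQ TC]] : exists T : H -> H, [/\ linear T, forall x y, inner (T x) y = Q x y &
    forall x, hsq (T x) <= M ^+ 2 * hsq x].
  apply: (riesz_form eo te) => [|a x y z|a x y z|x y].
  - exact: sqr_ge0.
  - apply: Qu; under eq_fun do rewrite (si_lin (qP _)).
    by apply: cvgD; [apply: cvgM; [exact: cvg_cst|exact: QP]|exact: QP].
  - apply: Qu; under eq_fun do rewrite (siDr (qP _)) (siZr (qP _)).
    by apply: cvgD; [apply: cvgM; [exact: cvg_cst|exact: QP]|exact: QP].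
  - have hb n : sc_nm (q n x y) <= Num.sqrt (M ^+ 2 * hsq x * hsq y).
      by rewrite -(ger0_norm (sc_nm_ge0 (q n x y))) -sqrtr_sqr ler_wsqrtr.
    rewrite -[leRHS]sqr_sqrtr ?mulr_ge0 ?sqr_ge0 ?hsq_ge0//.
    rewrite lerXn2r ?nnegrE ?sc_nm_ge0 ?sqrtr_ge0//.
    exact: sc_cvg_nm_le (QP x y) hb.
exists T; split => //; last by move=> a b; rewrite TQ; apply: Qu.
split=> [x y|x].
  rewrite TQ inner_conj TQ; apply/esym; rewrite -[RHS]sc_conjK; congr sc_conj.
  apply: Qu; have -> : (fun n => q n y x) = fun n => sc_conj (q n x y).
    by apply/funext => n; exact: si_conj.
  exact/sc_cvg_conj/QP.
by rewrite TQ; apply: (sc_cvg_ge0 (QP x x)) => n; exact: si_ge0.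
Qed.
End Families.
End Bases.

(** * Absolute value and trace of non-negative operators *)

Section Trace.
Context {R : realType} {k : scalar_kind}.
Local Notation F := (scalarField R k).

Section Operators.
Context {H : hilbertType R k}.
Implicit Types (x y z : H) (T A : H -> H).
Local Notation sP := (@inner_semi R k H).

Lemma bounded_hsq T : bounded_operator T ->
  exists2 C : R, 0 <= C & forall x, hsq (T x) <= C * hsq x.
Proof.
(* [M] is a scalar of F, unconstrained when the space is trivial, so its modulus is taken. *)
move=> [_ [M TM]]; exists (sc_nm M ^+ 2) => [|x]; first exact: sqr_ge0.
have : sc_nm `|T x| <= sc_nm (M * `|x|).
  rewrite -(@sc_ofR_le R k) !sc_nmE normr_id; apply: le_trans (TM x) _.
  by apply: real_ler_norm; rewrite ger0_real// (le_trans (normr_ge0 (T x)) (TM x)).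
rewrite sc_nmM -(@ler_sqr _ (sc_nm _)) ?nnegrE ?mulr_ge0 ?sc_nm_ge0// exprMn.
by rewrite /sc_nm !normr_id -!hsqE.
Qed.

Lemma hsq_norm_le T (C : R) x : 0 <= C -> hsq (T x) <= C ^+ 2 * hsq x ->
  `|T x| <= sc_ofR C * `|x|.
Proof.
move=> C0 h; rewrite !norm_ofR -sc_ofRM sc_ofR_le.
by rewrite -{1}(ger0_norm C0) -sqrtr_sqr -sqrtrM ?sqr_ge0// ler_wsqrtr.
Qed.

Lemma hsq_bounded T (C : R) : 0 <= C -> linear T ->
  (forall x, hsq (T x) <= C ^+ 2 * hsq x) -> bounded_operator T.
Proof. by move=> C0 Tl TC; split => //; exists (sc_ofR C) => x; exact: hsq_norm_le. Qed.

Definition op_form T x y : F := inner (T x) y.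

Lemma nonneg_semi T : nonneg_operator T -> semi_inner (op_form T).
Proof.
move=> [Th T0]; split => [a x y z|x y|x]; last exact: T0.
  by rewrite /op_form !Th innerP.
by rewrite /op_form Th inner_conj.
Qed.

(** Expanding |T x - x|^2 >= 0 gives 2 <T x, x> <= (C + 1) |x|^2, and <T x, x> <= 2 <T x, x>. This
    avoids a square root of C. *)
Lemma op_form_le T (C : R) x : nonneg_operator T -> (forall x, hsq (T x) <= C * hsq x) ->
  form_sq (op_form T) x <= (C + 1) * hsq x.
Proof.
move=> Tn TC; have := form_sq_ge0 sP (T x - x); rewrite (form_sqB sP).
have := form_sq_ge0 (nonneg_semi Tn) x.
have -> : sc_re (inner (T x) x) = form_sq (op_form T) x by [].
have := TC x; have := hsq_ge0 x; rewrite /hsq; lra.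
Qed.

(** Symmetry forces linearity, since T can be moved to the other argument; [nonneg_operator] thus
    also supplies linearity below. *)
Lemma nonnegD T x y : nonneg_operator T -> T (x + y) = T x + T y.
Proof.
by move=> [Th _]; apply: inner_ext => z; rewrite innerDl !Th innerDl.
Qed.

Lemma nonnegZ T a x : nonneg_operator T -> T (a *: x) = a *: T x.
Proof.
by move=> [Th _]; apply: inner_ext => z; rewrite innerZl !Th innerZl.
Qed.

Lemma nonnegB T x y : nonneg_operator T -> T (x - y) = T x - T y.
Proof. by move=> Tn; rewrite nonnegD// -scaleN1r nonnegZ// scaleN1r. Qed.

(* With [D = A - T] and [S = A + T], [A^2 = T^2] reads [S D = - D S], so
   [(1 + r S)^n D = D (1 - r S)^n]. For small [r > 0] the right-hand side stays
   bounded, whereas [|(1 + r S)^n y|^2 >= 2 n r <S y, y>]; hence [<S y, y> = 0] on the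
   range of [D]. *)
Lemma nonneg_sqrt_unique A T (C : R) : 0 <= C ->
  nonneg_operator A -> nonneg_operator T ->
  (forall x, hsq (A x) <= C * hsq x) -> (forall x, hsq (T x) <= C * hsq x) ->
  (forall x y, inner (A x) (A y) = inner (T x) (T y)) -> A = T.
Proof.
move=> C0 An Tn AC TC AT.
have sA := nonneg_semi An; have sT := nonneg_semi Tn.
pose D x := A x - T x; pose S x := A x + T x.
have AA x : A (A x) = T (T x) by apply: inner_ext => z; rewrite An.1 AT -Tn.1.
have Dh x y : inner (D x) y = inner x (D y) by rewrite (siBl sP) (siBr sP) An.1 Tn.1.
have Sn : nonneg_operator S.
  split=> [x y|x]; rewrite /S innerDl; last by rewrite addr_ge0 ?An.2 ?Tn.2.
  by rewrite innerDr An.1 Tn.1.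
have sS := nonneg_semi Sn; set N := form_sq (op_form S).
have Sh := Sn.1.
have SC x : hsq (S x) <= 4 * C * hsq x.
  by apply: le_trans (hsqD_le _ _) _; have := AC x; have := TC x; lra.
have DC x : hsq (D x) <= 4 * C * hsq x.
  by apply: le_trans (hsqD_le _ _) _; rewrite hsqN; have := AC x; have := TC x; lra.
have SD x : S (D x) = - D (S x).
  rewrite /S /D !(nonnegB _ _ An) !(nonnegB _ _ Tn) !(nonnegD _ _ An) !(nonnegD _ _ Tn) AA.
  by rewrite opprB [LHS]addrC addrA subrK opprD addrA addrK.
have DB x y : D (x - y) = D x - D y.
  by rewrite /D (nonnegB _ _ An) (nonnegB _ _ Tn) !opprB (addrC (T y)) addrACA [T y - _]addrC.
have DZ a x : D (a *: x) = a *: D x.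
  by rewrite /D (nonnegZ _ _ An) (nonnegZ _ _ Tn) scalerBr.
(* sqrt(4 C) bounds the norm of S; adding 1 makes t invertible, and r = 1/t is small enough for the
   argument. *)
pose t := Num.sqrt (4 * C) + 1; have t0 : 0 < t by rewrite ltr_wpDl// sqrtr_ge0.
(* Cauchy-Schwarz for the form of S: |S x|^4 <= <S x, x> <S(S x), S x> <= <S x, x> t |S x|^2. This
   is what makes 1 - r S a contraction. *)
have SN x : hsq (S x) <= t * N x.
  have h0 := hsq_ge0 (S x).
  have SS : N (S x) <= t * hsq (S x).
    apply: le_trans (_ : Num.sqrt (4 * C) * hsq (S x) <= _); last by rewrite ler_wpM2r// lerDl.
    rewrite -ler_sqr ?nnegrE ?form_sq_ge0 ?mulr_ge0 ?sqrtr_ge0//.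
    rewrite exprMn sqr_sqrtr ?mulr_ge0//.
    have h1 : N (S x) ^+ 2 <= sc_nm (inner (S (S x)) (S x)) ^+ 2.
      rewrite lerXn2r ?nnegrE ?form_sq_ge0 ?sc_nm_ge0//.
      by apply: le_trans (sc_re_le_nm _); rewrite ler_norm.
    apply: le_trans h1 _; apply: le_trans (inner_cs _ _) _.
    by rewrite [leRHS]mulrA ler_wpM2r.
  have [h|hn] := eqVneq (hsq (S x)) 0; first by rewrite h mulr_ge0 ?form_sq_ge0// ltW.
  have hp : 0 < hsq (S x) by rewrite lt_neqAle eq_sym hn.
  rewrite -(ler_pM2r hp) -expr2.
  apply: (@le_trans _ _ (N x * N (S x))); last by rewrite (mulrC t) -mulrA ler_wpM2l ?form_sq_ge0.
  apply: le_trans (form_cs sS x (S x)); rewrite /op_form inner_hsq sc_nm_ofR ger0_norm//.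
pose r := t^-1; have r0 : 0 < r by rewrite invr_gt0.
pose U x := x + sc_ofR r *: S x; pose V x := x - sc_ofR r *: S x.
have UD x : U (D x) = D (V x).
  by rewrite /U /V DB DZ SD scalerN.
have UDn n x : iter n U (D x) = D (iter n V x).
  by elim: n => //= n ->; rewrite UD.
have V1 x : hsq (V x) <= hsq x.
  rewrite /V /hsq (form_sqB sP) (form_sqZ sP) (siZr sP) sc_conj_ofR sc_nm_ofR.
  rewrite ger0_norm ?(ltW r0)// sc_reM sc_re_ofR sc_im_ofR mul0r subr0.
  have -> : sc_re (inner x (S x)) = N x by rewrite -Sh.
  rewrite -/(hsq _) -/(hsq _).
  have : r ^+ 2 * hsq (S x) <= r * N x.
    rewrite expr2 -mulrA ler_wpM2l ?(ltW r0)// ler_pdivrMl//.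
  have : 0 <= r * N x by rewrite mulr_ge0 ?(ltW r0)// form_sq_ge0.
  lra.
have Vn n x : hsq (iter n V x) <= hsq x.
  by elim: n => //= n; apply: le_trans.
have UN x : N x <= N (U x).
  rewrite /N /U (form_sqD sS) (form_sqZ sS) (siZr sS) sc_conj_ofR /op_form inner_hsq -sc_ofRM sc_re_ofR.
  have := form_sq_ge0 sS (S x); have := hsq_ge0 (S x); rewrite -/N => a b.
  have : 0 <= r * hsq (S x) by rewrite mulr_ge0// ltW.
  have : 0 <= sc_nm (sc_ofR r : F) ^+ 2 * N (S x) by rewrite mulr_ge0// sqr_ge0.
  rewrite -/N; lra.
have UNn n x : N x <= N (iter n U x).
  by elim: n => //= n ih; apply: le_trans ih _.
have Ugrow n x : 2 * n%:R * r * N x <= hsq (iter n U x).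
  elim: n => [|n ih]; first by rewrite mulr0 !mul0r hsq_ge0.
  rewrite iterS; set w := iter n U x in ih *.
  have nw : N x <= N w by exact: UNn.
  rewrite /U /hsq (form_sqD sP) (form_sqZ sP) (siZr sP) sc_conj_ofR.
  rewrite sc_reM sc_re_ofR sc_im_ofR mul0r subr0.
  have -> : sc_re (inner w (S w)) = N w by rewrite -Sh.
  rewrite -/(hsq w).
  have : 0 <= sc_nm (sc_ofR r : F) ^+ 2 * form_sq inner (S w).
    by rewrite mulr_ge0 ?sqr_ge0// hsq_ge0.
  have : r * N x <= r * N w by rewrite ler_wpM2l// ltW.
  rewrite -natr1; lra.
have N0 x : N (D x) = 0.
  apply/eqP; rewrite eq_le form_sq_ge0 // andbT leNgt; apply/negP => Np.
  have rp : 0 < 2 * r * N (D x) by rewrite !mulr_gt0.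
  have [n] : exists n : nat, 4 * C * hsq x / (2 * r * N (D x)) < n%:R.
    by exists (Num.truncn (4 * C * hsq x / (2 * r * N (D x)))).+1; rewrite truncnS_gt.
  rewrite ltr_pdivrMr// => h.
  have := Ugrow n (D x); rewrite UDn => h1.
  have := le_trans h1 (le_trans (DC _) _ : _ <= 4 * C * hsq x) => h2.
  have : 2 * n%:R * r * N (D x) <= 4 * C * hsq x.
    by apply: h2; rewrite ler_wpM2l ?mulr_ge0.
  lra.
apply/funext => x; apply/eqP; rewrite -subr_eq0; apply/eqP.
rewrite -/(D x); set y := D x.
have Ay0 : 0 <= form_sq (op_form A) y by exact: form_sq_ge0.
have Ty0 : 0 <= form_sq (op_form T) y by exact: form_sq_ge0.
(* <S y, y> = 0 is a sum of two non-negative terms, so A y = T y = 0 and |y|^2 = <x, D y> = 0. *)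
have sum0 : form_sq (op_form A) y + form_sq (op_form T) y = 0.
  by rewrite -(N0 x) /N /form_sq /op_form /S innerDl sc_reD.
have A0 : A y = 0.
  apply: inner_ext => z; rewrite inner0l; apply: (form_sq_null sA); lra.
have T0 : T y = 0.
  apply: inner_ext => z; rewrite inner0l; apply: (form_sq_null sT); lra.
by apply: hsq_eq0; rewrite /hsq /form_sq {1}/y Dh /D A0 T0 subrr (si0r sP) sc_re0.
Qed.

(** T belongs to the set from which [abs_op] chooses, and uniqueness of the non-negative root
    identifies the choice with T. *)
Lemma abs_op_nonneg T : bounded_operator T -> nonneg_operator T -> abs_op T = T.
Proof.
move=> Tb Tn; rewrite /abs_op.
case: xgetP => [A _ [Ab An AT]|/(_ T) []]; last by split.
have [C C0 TC] := bounded_hsq Tb; have [C' C'0 AC] := bounded_hsq Ab.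
apply: (@nonneg_sqrt_unique _ _ (C + C')) => //; first exact: addr_ge0.
  by move=> x; apply: le_trans (AC x) _; rewrite ler_wpM2r ?hsq_ge0// lerDr.
by move=> x; apply: le_trans (TC x) _; rewrite ler_wpM2r ?hsq_ge0// lerDl.
Qed.
End Operators.
End Trace.

Lemma esum_swap (R : realType) (I J : choiceType) (a : I -> J -> \bar R) :
  (forall i j, (0 <= a i j)%E) ->
  (\esum_(i in [set: I]) \esum_(j in [set: J]) a i j =
   \esum_(j in [set: J]) \esum_(i in [set: I]) a i j)%E.
Proof.
move=> a0; rewrite !esum_esum//.
rewrite (reindex_esum ([set: J] `*`` (fun=> [set: I])) _ (fun p => (p.2, p.1)))//.
split=> [[]//|[i j] [i' j'] _ _ [-> ->]//|[i j] _ /=].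
by exists (j, i).
Qed.

(** * The trace norm of a non-negative operator in an arbitrary basis *)

Section TraceNorm.
Context {R : realType} {k : scalar_kind}.
Local Notation F := (scalarField R k).

Context {H : hilbertType R k}.
Implicit Types (x y z : H) (T A : H -> H).
Local Notation sP := (@inner_semi R k H).
Local Notation ionz := (@onz R k H inner _).

(** The index type is arbitrary and zero vectors are harmless, so a basis given as a set E can be
    indexed by the whole space H, with 0 outside E. *)
Definition parseval_frame {I : choiceType} (z : I -> H) : Prop :=
  forall y, \esum_(i in [set: I]) (sc_nm (inner y (z i)) ^+ 2)%:E = (hsq y)%:E.

(* The value does not depend on [z]; [g] is a Gram-Schmidt family of the form
   [<T x, y>], for which Parseval's identity reads [<T x, x> = sum_n |<x, T g_n>|^2]. *)
Lemma trace_frame T (C : R) (b : nat -> H) :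
  total (range b) -> nonneg_operator T -> (forall x, hsq (T x) <= C * hsq x) ->
  exists g : nat -> H, forall (I : choiceType) (z : I -> H), parseval_frame z ->
    \esum_(i in [set: I]) (sc_re (inner (T (z i)) (z i)))%:E =
    \esum_(n in [set: nat]) (hsq (T (g n)))%:E.
Proof.
move=> tb Tn TC; have sT := nonneg_semi Tn.
pose g := gram_schmidt (op_form T) b.
have go : onz (op_form T) g := gram_schmidt_onz sT b.
have C1 : 0 < `|C| + 1 by rewrite ltr_wpDl.
(* The form of T is dominated by the norm, so the vectors approximable for the form make up a
   norm-closed subspace; it contains the total sequence b. *)
have ga x : approximable (op_form T) g x.
  apply: tb; last first.
    move=> _ [n _ <-] e e0; exists (iota 0 n.+1); first exact: iota_uniq.
    by rewrite (gram_schmidt_res sT).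
  split; [exact: approximable0|by move=> a u v; exact: approximable_lin|].
  move=> u h; apply: (approximable_closed sT go) => e e0.
  have [y gy uy] := h _ (divr_gt0 e0 C1); exists y => //.
  apply: le_lt_trans (op_form_le _ Tn TC) _.
  apply: (@le_lt_trans _ _ ((`|C| + 1) * hsq (u - y))).
    by rewrite ler_wpM2r ?hsq_ge0// lerD2r ler_norm.
  by rewrite mulrC -ltr_pdivlMr.
exists g => I z pz.
transitivity (\esum_(i in [set: I]) \esum_(n in [set: nat])
    (sc_nm (inner (T (g n)) (z i)) ^+ 2)%:E).
  apply: eq_esum => i _; rewrite -[LHS](parseval sT go (ga (z i))).
  apply: eq_esum => n _; rewrite /op_form.
  by rewrite -sc_nm_conj -inner_conj Tn.1.
rewrite esum_swap => [|i n]; last by rewrite lee_fin sqr_ge0.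
by apply: eq_esum => n _; exact: pz.
Qed.

Lemma orthonormal_basis_frame (E : set H) : orthonormal_basis E ->
  parseval_frame (fun x : H => if x \in E then x else 0).
Proof.
move=> [Eo Ed] y; apply: total_parseval.
  split=> [i j ij|i].
    case: ifPn => iE; last exact: inner0l.
    case: ifPn => jE; last exact: (si0r sP).
    rewrite (Eo _ _ (set_mem iE) (set_mem jE)).
    by move/eqP/negPf: ij => ->.
  case: ifPn => iE; [right|by left].
  by rewrite (Eo _ _ (set_mem iE) (set_mem iE)) eqxx.
move=> P cP gP; apply: (lin_span_dense_total Ed) => // x Ex; apply: gP.
by exists x => //; rewrite mem_set.
Qed.

(** Shows that an orthonormal basis exists, so that [some_basis] is one and not its default
    [set0]. *)
Lemma onz_basis {I : Type} (f : I -> H) : ionz f -> total (range f) ->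
  orthonormal_basis [set x | x <> 0 /\ range f x].
Proof.
move=> fo tf; split=> [x y [_ [i _ xE]] [y0 [j _ yE]]|]; first rewrite -xE -yE in y0 *.
  case: eqVneq => [->|ij]; last by rewrite fo.1// => e; rewrite e eqxx in ij.
  by have [//|->] := fo.2 j.
apply: total_lin_span_dense => P cP EP; apply: tf => // x fx.
have [->|/eqP x0] := eqVneq x 0; first by case: cP.
exact: EP.
Qed.

Lemma trace_norm_frame T (b : nat -> H) (I : choiceType) (z : I -> H) :
  ionz b -> total (range b) -> bounded_operator T -> nonneg_operator T -> parseval_frame z ->
  trace_norm T = \esum_(i in [set: I]) (sc_re (inner (T (z i)) (z i)))%:E.
Proof.
move=> bo tb Tb Tn pz; rewrite /trace_norm abs_op_nonneg//.
have [C _ TC] := bounded_hsq Tb; have [g gP] := trace_frame tb Tn TC.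
have bE : orthonormal_basis (some_basis : set H).
  exact: (xgetPex (set0 : set H) (ex_intro _ _ (onz_basis bo tb))).
rewrite (gP _ _ pz) -(gP _ _ (orthonormal_basis_frame bE)) esum_mkcond.
apply: eq_esum => x _; case: ifP => // _; by rewrite (si0r sP) sc_re0.
Qed.
End TraceNorm.

(** * Riemann sums for scalar measures *)

Section Riemann.
Context d (X : measurableType d) {R : realType} {k : scalar_kind}.
Local Notation F := (scalarField R k).

Definition bounded_measurable (h : X -> R) : Prop :=
  measurable_fun setT h /\ exists C : R, forall x, `|h x| <= C.

Definition sc_bounded_measurable (h : X -> F) : Prop :=
  bounded_measurable (fun x => sc_re (h x)) /\ bounded_measurable (fun x => sc_im (h x)).

(** Encoding the cells as the fibres of a map to a finite type makes them disjoint and covering by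
    construction. Cells may be empty, and tags need not lie in their cells. *)
Record tagged_partition := TaggedPartition {
  tp_index : finType ;
  tp_cell : X -> tp_index ;
  tp_tag : tp_index -> X ;
  tp_measurable : forall t, measurable (tp_cell @^-1` [set t])
}.

Definition riemann_sum (P : tagged_partition) (mu : set X -> F) (h : X -> F) : F :=
  \sum_t h (tp_tag t) * mu (@tp_cell P @^-1` [set t]).

Lemma bounded_measurable_integrable (mu : {finite_measure set X -> \bar R}) h :
  bounded_measurable h -> mu.-integrable setT (EFin \o h).
Proof.
move=> [mh [C hC]]; apply: measurable_bounded_integrable => //.
  by rewrite ltey_eq fin_num_measure.
exists C; split; first exact: num_real.
by move=> y Cy x _ /=; apply: le_trans (hC x) (ltW Cy).
Qed.

Lemma Rintegral_riemann (mu : {finite_measure set X -> \bar R}) (h : X -> R)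
    (P : tagged_partition) (e : R) :
  bounded_measurable h -> (forall x, `|h x - h (tp_tag (tp_cell P x))| <= e) ->
  `| \int[mu]_x h x - \sum_t h (tp_tag t) * fine (mu (@tp_cell P @^-1` [set t])) | <=
  e * fine (mu setT).
Proof.
move=> bh he; case: (bh) => mh [C hC].
pose B t := @tp_cell P @^-1` [set t].
have mB t : measurable (B t) by exact: tp_measurable.
pose g (s : seq (tp_index P)) x := \sum_(t <- s) h (tp_tag t) * \1_(B t) x.
have bi t : bounded_measurable (\1_(B t) : X -> R).
  split; first exact: measurable_indic.
  by exists 1 => x; rewrite indicE; case: (_ \in _); rewrite ?normr0 ?normr1.
have bg s : bounded_measurable (g s).
  elim: s => [|t s [ms [D sD]]].
    split; first by rewrite /g; under eq_fun do rewrite big_nil; exact: measurable_cst.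
    by exists 0 => x; rewrite /g big_nil normr0.
  have E : g (t :: s) = (fun x => h (tp_tag t) * \1_(B t) x + g s x).
    by apply/funext => x; rewrite /g big_cons.
  case: (bi t) => mi [D' iD]; split.
    rewrite E; apply: measurable_funD => //.
    by apply: measurable_funM => //; exact: measurable_cst.
  exists (`|h (tp_tag t)| * D' + D) => x; rewrite E; apply: le_trans (ler_normD _ _) _.
  by rewrite lerD// normrM ler_wpM2l.
have Ig s : \int[mu]_x g s x = \sum_(t <- s) h (tp_tag t) * fine (mu (B t)).
  elim: s => [|t s ih].
    by rewrite big_nil /g; under eq_Rintegral do rewrite big_nil; rewrite Rintegral_cst// mul0r.
  rewrite big_cons -ih; transitivity (\int[mu]_x (h (tp_tag t) * \1_(B t) x + g s x)).
    by apply: eq_Rintegral => x _; rewrite /g big_cons.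
  have it := bounded_measurable_integrable mu (bi t).
  rewrite RintegralD//; last 2 first.
  - by rewrite (_ : EFin \o _ = (fun x => (h (tp_tag t))%:E * (\1_(B t) x)%:E)%E)//; exact: integrableZl.
  - exact: bounded_measurable_integrable.
  congr (_ + _); rewrite RintegralZl//; congr (_ * _).
  by rewrite /Rintegral integral_indic// setIT.
set s := index_enum (tp_index P).
have gE x : g s x = h (tp_tag (tp_cell P x)).
  rewrite /g (bigD1_seq (tp_cell P x)) ?mem_index_enum ?index_enum_uniq//=.
  rewrite big1 ?addr0 => [|t tx]; first by rewrite indicE mem_set ?mulr1.
  by rewrite indicE memNset ?mulr0// => /= xt; rewrite -xt eqxx in tx.
rewrite -Ig -RintegralB ?bounded_measurable_integrable//.
have bhg : bounded_measurable (fun x => h x - g s x).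
  split; first by apply: measurable_funB => //; case: (bg s).
  by exists e => x; rewrite gE.
apply: le_trans (le_normr_Rintegral _ _) _ => //; first exact: bounded_measurable_integrable.
rewrite -Rintegral_cst//; apply: le_Rintegral => //.
- apply: bounded_measurable_integrable; case: bhg => m1 [D hD]; split.
    exact: measurableT_comp.
  by exists D => x; rewrite normr_id.
- exact: finite_measure_integrable_cst.
- by move=> x _; rewrite gE.
Qed.

(** C is the total mass of the two Jordan parts. It is fixed before the function and the partition,
    so a partition adapted to the function alone works for every charge. *)
Lemma charge_riemann (rho : {charge set X -> \bar R}) :
  exists2 C : R, 0 <= C & forall (h : X -> R) (P : tagged_partition) (e : R),
  bounded_measurable h -> (forall x, `|h x - h (tp_tag (tp_cell P x))| <= e) ->
  `| charge_integral rho h - \sum_t h (tp_tag t) * fine (rho (@tp_cell P @^-1` [set t])) | <=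
  C * e.
Proof.
set PN := svalP (hahn_pair rho).
exists (fine (jordan_pos PN setT) + fine (jordan_neg PN setT)).
  by rewrite addr_ge0// fine_ge0.
move=> h P e bh he.
have := Rintegral_riemann (jordan_pos PN) bh he.
have := Rintegral_riemann (jordan_neg PN) bh he.
rewrite /charge_integral -/PN.
set I1 := Rintegral _ _ _; set I2 := Rintegral _ _ _.
set S1 := \sum_t _; set S2 := \sum_t _; set S3 := \sum_t _.
have -> : S3 = S2 - S1.
  rewrite /S3 /S2 /S1 -sumrB; apply: eq_bigr => t _; rewrite -mulrBr; congr (_ * _).
  rewrite (jordan_decomp PN); last exact: tp_measurable.
  rewrite /cadd /=.
  rewrite (_ : cscale (-1) _ _ = - jordan_neg PN (@tp_cell P @^-1` [set t]))%E; last by rewrite /cscale /= mulN1e.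
  by rewrite fineB// fin_num_measure//; exact: tp_measurable.
have -> : I2 - I1 - (S2 - S1) = (I2 - S2) - (I1 - S1) by ring.
move=> h1 h2; apply: le_trans (ler_normB _ _) _; lra.
Qed.

Lemma scalar_riemann (mu : scalar_measure X R k) :
  exists2 C : R, 0 <= C & forall (h : X -> F) (P : tagged_partition) (e : R),
  sc_bounded_measurable h -> (forall x, sc_nm (h x - h (tp_tag (tp_cell P x))) <= e) ->
  sc_nm (scalar_integral mu h - riemann_sum P mu h) <= C * e.
Proof.
have [C C0 CP] := charge_riemann (re_charge mu).
have [D D0 DP] := charge_riemann (im_charge mu).
(* Both charges enter the real part and the imaginary part of the error, whence the factor 2. *)
exists (2 * (C + D)); first by rewrite mulr_ge0// addr_ge0.
move=> h P e [br bi] he.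
have hr x : `|sc_re (h x) - sc_re (h (tp_tag (tp_cell P x)))| <= e.
  by rewrite -sc_reN -sc_reD; exact: le_trans (sc_re_le_nm _) _.
have hi x : `|sc_im (h x) - sc_im (h (tp_tag (tp_cell P x)))| <= e.
  by rewrite -sc_imN -sc_imD; exact: le_trans (sc_im_le_nm _) _.
have := CP _ _ _ br hr; have := CP _ _ _ bi hi.
have := DP _ _ _ br hr; have := DP _ _ _ bi hi.
rewrite /scalar_integral.
set a := charge_integral _ _; set b := charge_integral _ _.
set a' := charge_integral _ _; set b' := charge_integral _ _.
set A := \sum_t _; set B := \sum_t _; set A' := \sum_t _; set B' := \sum_t _.
move=> ha hb ha' hb'.
have rS : sc_re (riemann_sum P mu h) = B' - A.
  rewrite sc_re_sumr /B' /A -sumrB; apply: eq_bigr => t _; rewrite sc_reM//.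
have iS : sc_im (riemann_sum P mu h) = B + A'.
  rewrite sc_im_sumr /B /A' -big_split/=; apply: eq_bigr => t _; rewrite sc_imM/=; ring.
apply: le_trans (sc_nm_le _) _.
rewrite sc_reD sc_imD sc_reN sc_imN sc_re_mk rS.
have im_le (u v : R) (z : F) : `|sc_im (sc_mk u v : F) - sc_im z| <= `|v - sc_im z|.
  by case: k z => [z|z] //=; rewrite subrr normr0.
have := im_le (b' - a) (b + a') (riemann_sum P mu h); rewrite iS => him.
apply: le_trans (lerD (lexx _) him) _.
have -> : b' - a - (B' - A) = (b' - B') - (a - A) by ring.
have -> : b + a' - (B + A') = (b - B) + (a' - A') by ring.
apply: le_trans (lerD (ler_normB _ _) (ler_normD _ _)) _.
move: ha hb ha' hb'; rewrite /a /b /a' /b' /A /B /A' /B'; lra.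
Qed.
End Riemann.

(** * Fine partitions, convergence of Riemann sums, linearity of the integral *)

Section Partitions.
Context d (X : measurableType d) {R : realType} {k : scalar_kind}.
Local Notation F := (scalarField R k).
Local Notation bm := (@bounded_measurable d X R).
Local Notation sbm := (@sc_bounded_measurable d X R k).
Implicit Types (f g : X -> R).

Lemma bm_cst (c : R) : bm (fun=> c).
Proof. by split; [exact: measurable_cst|exists `|c|]. Qed.

Lemma bmD f g : bm f -> bm g -> bm (fun x => f x + g x).
Proof.
move=> [mf [C fC]] [mg [D gD]]; split; first exact: measurable_funD.
by exists (C + D) => x; apply: le_trans (ler_normD _ _) _; rewrite lerD.
Qed.

Lemma bmM f g : bm f -> bm g -> bm (fun x => f x * g x).
Proof.
move=> [mf [C fC]] [mg [D gD]]; split; first exact: measurable_funM.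
by exists (C * D) => x; rewrite normrM ler_pM.
Qed.

Lemma bmN f : bm f -> bm (fun x => - f x).
Proof.
move=> /(bmM (bm_cst (-1))); congr bounded_measurable.
by apply/funext => x; rewrite mulN1r.
Qed.

Lemma sbm_cst (c : F) : sbm (fun=> c).
Proof. by split; exact: bm_cst. Qed.

Lemma sbmD (f g : X -> F) : sbm f -> sbm g -> sbm (fun x => f x + g x).
Proof.
move=> [fr fi] [gr gi]; split.
  by under eq_fun do rewrite sc_reD; exact: bmD.
by under eq_fun do rewrite sc_imD; exact: bmD.
Qed.

Lemma sbmM (f g : X -> F) : sbm f -> sbm g -> sbm (fun x => f x * g x).
Proof.
move=> [fr fi] [gr gi]; split.
  by under eq_fun do rewrite sc_reM; apply: bmD; [|apply: bmN]; exact: bmM.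
by under eq_fun do rewrite sc_imM; apply: bmD; exact: bmM.
Qed.

Lemma sbm_conj (f : X -> F) : sbm f -> sbm (fun x => sc_conj (f x)).
Proof.
move=> [fr fi]; split; first by under eq_fun do rewrite sc_re_conj.
by under eq_fun do rewrite sc_im_conj; exact: bmN.
Qed.

Lemma unit_partition_subproof (t : unit) : measurable ((fun _ : X => tt) @^-1` [set t]).
Proof. by case: t; rewrite (_ : _ @^-1` _ = setT)//; apply/seteqP; split. Qed.

Definition unit_partition : tagged_partition X :=
  TaggedPartition (fun=> point) unit_partition_subproof.

(* Two points lie in the same cell when they exceed the same levels [m e - C]. *)
Lemma fine_partition (J : finType) (g : J -> X -> R) (e : R) :
  (forall j, bm (g j)) -> 0 < e ->
  exists P : tagged_partition X, forall j x, `|g j x - g j (tp_tag (tp_cell P x))| <= e.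
Proof.
move=> bg e0.
have [C gC] : exists C : R, forall j x, `|g j x| <= C.
  have [D gD] := choice (fun j => (bg j).2).
  exists (\sum_j `|D j|) => j x; rewrite (bigD1 j)//=.
  apply: le_trans (gD j x) _; apply: le_trans (ler_norm _) _.
  by rewrite lerDl sumr_ge0.
(* The levels run from -C to one beyond C: the last one, for m = N - 1, exceeds C. *)
pose N := (Num.truncn (2 * C / e)).+2.
pose lev (m : 'I_N) := m%:R * e - C.
pose cell x := [ffun p : J * 'I_N => lev p.2 <= g p.1 x].
pose tag t := xget point [set x | cell x = t].
have mc t : measurable (cell @^-1` [set t]).
  have -> : cell @^-1` [set t] = \bigcap_(p in [set: J * 'I_N]) [set x | (lev p.2 <= g p.1 x) = t p].
    apply/seteqP; split => [x /= <- p _|x h /=]; first by rewrite /cell ffunE.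
    by apply/ffunP => p; rewrite /cell ffunE; exact: (h p).
  apply: fin_bigcap_measurable => [|p _]; first exact: finite_finset.
  have -> : [set x | (lev p.2 <= g p.1 x) = t p] = (g p.1) @^-1` [set r | (lev p.2 <= r) = t p] by [].
  rewrite -[X in measurable X]setTI; apply: (bg p.1).1 => //.
  case: (t p).
    by rewrite (_ : [set r | _] = `[lev p.2, +oo[%classic)//; apply/seteqP; split => r /=; rewrite in_itv /= andbT.
  rewrite (_ : [set r | _] = `]-oo, lev p.2[%classic)//; apply/seteqP; split => r /=; rewrite in_itv /=.
    by move=> /negbT; rewrite -ltNge.
  by move=> rl; apply/negbTE; rewrite -ltNge.
exists (TaggedPartition tag mc) => j x /=.
have : cell (tag (cell x)) = cell x.
  exact: (xgetPex point (ex_intro [set y | cell y = cell x] x erefl)).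
move: (tag (cell x)) => y cxy.
have key u v : cell u = cell v -> g j u - g j v <= e.
  move=> uv; rewrite leNgt; apply/negP => lt.
  have Cu := gC j u; have Cv := gC j v.
  have v0 : 0 <= (g j v + C) / e.
    by rewrite divr_ge0 ?(ltW e0)//; move: Cv; rewrite ler_norml; lra.
  (* The first level strictly above [g j v]. It is at most [g j v + e], so it lies below [g j u] and
     separates u from v. *)
  pose m := (Num.truncn ((g j v + C) / e)).+1.
  have /andP[m1 m2] := truncn_itv v0.
  have mN : (m < N)%N.
    rewrite /m /N !ltnS; apply: le_truncn; rewrite ler_pM2r ?invr_gt0//.
    move: Cv; rewrite ler_norml; lra.
  move/ffunP/(_ (j, Ordinal mN)): uv; rewrite !ffunE /lev /=.
  move: m1 m2; rewrite ler_pdivlMr// ltr_pdivrMr// -/m => m1 m2.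
  have -> : (m%:R * e - C <= g j v) = false by apply/negbTE; rewrite -ltNge; lra.
  by move=> /negbT; rewrite -ltNge /m -natr1; lra.
have := key x y (esym cxy); have := key y x cxy; rewrite ler_norml => ? ?.
apply/andP; split; lra.
Qed.

(** The partitions are common to a finite family of functions and to all measures, so identities
    between finite sums pass to the limit in the function and in the measure. *)
Lemma riemann_cvg (I : finType) (h : I -> X -> F) : (forall i, sbm (h i)) ->
  exists P : nat -> tagged_partition X, forall i (mu : scalar_measure X R k),
    (fun n => riemann_sum (P n) mu (h i)) @ \oo --> scalar_integral mu (h i).
Proof.
move=> bh.
pose g (p : I * bool) x := if p.2 then sc_re (h p.1 x) else sc_im (h p.1 x).
have bg p : bm (g p) by case: p => i [] /=; case: (bh i).
have /choice[P PP] (n : nat) : exists P : tagged_partition X,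
    forall i x, sc_nm (h i x - h i (tp_tag (tp_cell P x))) <= n.+1%:R^-1.
  have e0 : 0 < n.+1%:R^-1 :> R by rewrite invr_gt0.
  move: (n.+1%:R^-1 : R) e0 => e /(divr_gt0)/(_ (ltr0n _ 2)) e0.
  have [P hP] := fine_partition bg e0; exists P => i x.
  apply: le_trans (sc_nm_le _) _; rewrite sc_reD sc_imD sc_reN sc_imN.
  have := hP (i, true) x; have := hP (i, false) x; rewrite /g /=; lra.
exists P => i mu; have [C C0 CP] := scalar_riemann mu.
apply/sc_cvgP => e e0.
exists (Num.truncn (C / e)).+1 => // n /= Cn.
rewrite -sc_nmN opprB; apply: le_lt_trans (CP _ _ _ (bh i) (PP n i)) _.
rewrite ltr_pdivrMr//; rewrite -ltr_pdivrMl// mulrC.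
apply: lt_le_trans (truncnS_gt _) _.
by rewrite ler_nat (leq_trans Cn).
Qed.

Lemma scalar_integral_lin (mu : scalar_measure X R k) (a : F) (h g : X -> F) :
  sbm h -> sbm g ->
  scalar_integral mu (fun x => a * h x + g x) = a * scalar_integral mu h + scalar_integral mu g.
Proof.
move=> bh bg.
pose f (i : 'I_3) := tnth [tuple h; g; fun x => a * h x + g x] i.
have bf i : sbm (f i).
  by case: i => -[|[|[|]]] //= ?; apply: sbmD => //; apply: sbmM => //; exact: sbm_cst.
have [P PP] := riemann_cvg bf.
have Ph := PP (inord 0) mu; have Pg := PP (inord 1) mu; have Pa := PP (inord 2) mu.
rewrite /f !(tnth_nth h) !inordK//= in Ph Pg Pa.
apply: (sc_cvg_unique Pa).
have -> : (fun n => riemann_sum (P n) mu (fun x => a * h x + g x)) =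
    (fun n => a * riemann_sum (P n) mu h + riemann_sum (P n) mu g).
  apply/funext => n; rewrite /riemann_sum mulr_sumr -big_split/=.
  by apply: eq_bigr => t _; ring.
by apply: cvgD => //; apply: cvgM => //; exact: cvg_cst.
Qed.

(** The constant 1 has Riemann error 0 for every partition; P is compared with the one-cell
    partition. *)
Lemma riemann_sum1 (mu : scalar_measure X R k) (P : tagged_partition X) :
  \sum_t mu (@tp_cell _ _ P @^-1` [set t]) = mu setT.
Proof.
have [C C0 CP] := scalar_riemann mu.
have E Q : scalar_integral mu (fun=> 1) = riemann_sum Q mu (fun=> 1).
  apply/eqP; rewrite -subr_eq0; apply/eqP/sc_nm_eq0/eqP; rewrite eq_le sc_nm_ge0 andbT.
  have := CP (fun=> 1) Q 0 (sbm_cst 1); rewrite mulr0; apply => x.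
  by rewrite subrr sc_nm0.
have := E P; rewrite (E unit_partition) /riemann_sum => /esym.
under eq_bigr do rewrite mul1r.
under [in X in _ = X -> _]eq_bigr do rewrite mul1r.
move=> ->; rewrite (bigD1 tt)//= big1 ?addr0 => [|[]//].
by congr (mu _); apply/seteqP; split.
Qed.

Lemma charge_integral_cvg (rho : {charge set X -> \bar R}) (h : nat -> X -> R)
    (g : X -> R) (C : R) :
  (forall n, measurable_fun setT (h n)) -> measurable_fun setT g ->
  (forall n x, `|h n x| <= C) -> (forall x, (fun n => h n x) @ \oo --> g x) ->
  (fun n => charge_integral rho (h n)) @ \oo --> charge_integral rho g.
Proof.
move=> mh mg hC hg.
have key (mu : {finite_measure set X -> \bar R}) :
    (fun n => \int[mu]_x h n x) @ \oo --> \int[mu]_x g x.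
  have [||||| ig _ hI] := @dominated_convergence _ _ _ mu setT measurableT
    (fun n => EFin \o h n) (EFin \o g) (cst C%:E).
  - by move=> n; exact/measurable_EFinP.
  - exact/measurable_EFinP.
  - by apply: aeW => x _; apply: cvg_EFin; [exact: nearW|exact: hg].
  - exact: finite_measure_integrable_cst.
  - by apply: aeW => x n _ /=; rewrite lee_fin.
  by apply: fine_cvg; rewrite fineK//; exact: integrable_fin_num.
by apply: cvgB; exact: key.
Qed.
End Partitions.

(** * Integrals against a POVM *)

Lemma sum_cs (R : realType) (I : Type) (r : seq I) (a b c : I -> R) :
  (forall i, 0 <= a i) -> (forall i, 0 <= b i) -> (forall i, 0 <= c i) ->
  (forall i, c i ^+ 2 <= a i * b i) ->
  (\sum_(i <- r) c i) ^+ 2 <= (\sum_(i <- r) a i) * (\sum_(i <- r) b i).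
Proof.
move=> a0 b0 c0 cab; elim: r => [|i r ih]; first by rewrite !big_nil mul0r expr0n.
rewrite !big_cons; set A := \sum_(j <- r) a j in ih *; set B := \sum_(j <- r) b j in ih *.
set S := \sum_(j <- r) c j in ih *.
have A0 : 0 <= A by exact: sumr_ge0.
have B0 : 0 <= B by exact: sumr_ge0.
have S0 : 0 <= S by exact: sumr_ge0.
have ai := a0 i; have bi := b0 i; have ci := c0 i; have ci2 := cab i.
have : 2 * (c i * S) <= a i * B + A * b i.
  rewrite -ler_sqr ?nnegrE ?addr_ge0 ?mulr_ge0//.
  have : (c i * S) ^+ 2 <= (a i * B) * (A * b i).
    rewrite exprMn; apply: (@le_trans _ _ ((a i * b i) * (A * B))).
      by rewrite ler_pM ?sqr_ge0.
    by have -> : a i * b i * (A * B) = a i * B * (A * b i) by ring.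
  have := sqr_ge0 (a i * B - A * b i).
  set u := a i * B; set v := A * b i; set w := c i * S; lra.
lra.
Qed.

Section Povm.
Context d (X : measurableType d) {R : realType} {k : scalar_kind}.
Local Notation F := (scalarField R k).
Local Notation sbm := (@sc_bounded_measurable d X R k).
Context {Q : hilbertType R k} (nu : povm X Q).
Implicit Types (phi psi : Q) (P : tagged_partition X) (h : X -> F).

Definition cell_form P (t : tp_index P) : Q -> Q -> F := op_form (nu (@tp_cell _ _ P @^-1` [set t])).
Arguments cell_form : clear implicits.

Lemma cell_form_semi P t : semi_inner (cell_form P t).
Proof. by apply: nonneg_semi; apply: povm_nonneg; exact: tp_measurable. Qed.

(** This is where nu(X) = I enters the estimates. *)
Lemma cell_form_sum P phi : \sum_t form_sq (cell_form P t) phi = hsq phi.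
Proof.
transitivity (sc_re (povm_coef nu phi phi setT)); last by rewrite /povm_coef povmT.
rewrite -sc_re_sumr; congr sc_re; exact: (riemann_sum1 (povm_measure nu phi phi) P).
Qed.

Lemma riemann_povmE P phi psi h :
  riemann_sum P (povm_measure nu phi psi) h = \sum_t h (tp_tag t) * cell_form P t phi psi.
Proof. by []. Qed.

(** Cauchy-Schwarz is applied to the form of each cell and then to the sum over the cells, so the
    bound involves |phi| and |psi| and not the total variation of nu_{phi,psi}. *)
Lemma povm_form_le phi psi h (C : R) : sbm h -> 0 <= C ->
  (forall x, sc_nm (h x) ^+ 2 <= C) ->
  sc_nm (scalar_integral (povm_measure nu phi psi) h) ^+ 2 <= C * hsq phi * hsq psi.
Proof.
move=> bh C0 hC; have [P PP] := riemann_cvg (fun _ : unit => bh).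
have Pc := PP tt (povm_measure nu phi psi).
have B0 : 0 <= C * hsq phi * hsq psi by rewrite !mulr_ge0 ?hsq_ge0.
rewrite -[leRHS]sqr_sqrtr// lerXn2r ?nnegrE ?sc_nm_ge0 ?sqrtr_ge0//.
apply: (sc_cvg_nm_le Pc) => n.
rewrite -(ger0_norm (sc_nm_ge0 _)) -sqrtr_sqr ler_wsqrtr// riemann_povmE.
pose c (t : tp_index (P n)) := sc_nm (cell_form (P n) t phi psi).
have h1 : sc_nm (\sum_t h (tp_tag t) * cell_form (P n) t phi psi) <=
    Num.sqrt C * \sum_t c t.
  rewrite mulr_sumr; apply: le_trans (sc_nm_sum _ _) _; apply: ler_sum => t _.
  rewrite sc_nmM ler_wpM2r ?sc_nm_ge0//.
  by rewrite -(ger0_norm (sc_nm_ge0 _)) -sqrtr_sqr ler_wsqrtr.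
have S0 : 0 <= \sum_t c t by apply: sumr_ge0 => t _; exact: sc_nm_ge0.
apply: (@le_trans _ _ ((Num.sqrt C * \sum_t c t) ^+ 2)).
  by rewrite lerXn2r ?nnegrE ?sc_nm_ge0 ?mulr_ge0 ?sqrtr_ge0.
rewrite exprMn sqr_sqrtr// -mulrA ler_wpM2l//.
rewrite -(cell_form_sum (P n) phi) -(cell_form_sum (P n) psi).
apply: sum_cs => t; rewrite ?sc_nm_ge0 ?form_sq_ge0//; try exact: cell_form_semi.
by apply: form_cs; exact: cell_form_semi.
Qed.

Lemma povm_form_linl a phi phi' psi h : sbm h ->
  scalar_integral (povm_measure nu (a *: phi + phi') psi) h =
  a * scalar_integral (povm_measure nu phi psi) h + scalar_integral (povm_measure nu phi' psi) h.
Proof.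
move=> bh; have [P PP] := riemann_cvg (fun _ : unit => bh).
apply: (sc_cvg_unique (PP tt _)).
have -> : (fun n => riemann_sum (P n) (povm_measure nu (a *: phi + phi') psi) h) =
  (fun n => a * riemann_sum (P n) (povm_measure nu phi psi) h +
            riemann_sum (P n) (povm_measure nu phi' psi) h).
  apply/funext => n; rewrite !riemann_povmE mulr_sumr -big_split/=.
  by apply: eq_bigr => t _; rewrite (si_lin (cell_form_semi t)); ring.
by apply: cvgD; [apply: cvgM; [exact: cvg_cst|]|]; exact: (PP tt).
Qed.

Lemma povm_form_conj phi psi h : sbm h ->
  scalar_integral (povm_measure nu psi phi) (fun x => sc_conj (h x)) =
  sc_conj (scalar_integral (povm_measure nu phi psi) h).
Proof.
move=> bh.
(* Indexing h and its conjugate by a boolean gives them the same partitions. *)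
have bh2 (b : bool) : sbm (fun x => if b then h x else sc_conj (h x)).
  by case: b => //; exact: sbm_conj.
have [P PP] := riemann_cvg bh2.
apply: (sc_cvg_unique (PP false _)).
have -> : (fun n => riemann_sum (P n) (povm_measure nu psi phi) (fun x => sc_conj (h x))) =
  (fun n => sc_conj (riemann_sum (P n) (povm_measure nu phi psi) h)).
  apply/funext => n; rewrite !riemann_povmE sc_conj_sum.
  by apply: eq_bigr => t _; rewrite sc_conjM (si_conj (cell_form_semi t)).
exact: sc_cvg_conj (PP true _).
Qed.

Lemma povm_form_linr a phi psi psi' h : sbm h ->
  scalar_integral (povm_measure nu phi (a *: psi + psi')) h =
  sc_conj a * scalar_integral (povm_measure nu phi psi) h + scalar_integral (povm_measure nu phi psi') h.
Proof.
move=> bh; have bc := sbm_conj bh.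
have E u : scalar_integral (povm_measure nu phi u) h =
    sc_conj (scalar_integral (povm_measure nu u phi) (fun x => sc_conj (h x))).
  rewrite -(povm_form_conj _ _ bc); congr scalar_integral.
  by apply/funext => x; rewrite sc_conjK.
by rewrite !E povm_form_linl// sc_conjD sc_conjM.
Qed.

Lemma povm_form_ge0 phi h : sbm h -> (forall x, 0 <= h x) ->
  0 <= scalar_integral (povm_measure nu phi phi) h.
Proof.
move=> bh h0; have [P PP] := riemann_cvg (fun _ : unit => bh).
apply: (sc_cvg_ge0 (PP tt _)) => n; rewrite riemann_povmE.
by apply: sumr_ge0 => t _; rewrite mulr_ge0//; exact: si_ge0 (cell_form_semi t) _.
Qed.

Lemma povm_integralP (e : nat -> Q) h (C : R) :
  onz inner e -> total (range e) -> sbm h -> 0 <= C -> (forall x, sc_nm (h x) ^+ 2 <= C) ->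
  bounded_operator (povm_integral nu h) /\
  forall phi psi, inner (povm_integral nu h phi) psi = scalar_integral (povm_measure nu phi psi) h.
Proof.
move=> eo te bh C0 hC.
have [T [Tl TE TC]] : exists T : Q -> Q, [/\ linear T,
    forall phi psi, inner (T phi) psi = scalar_integral (povm_measure nu phi psi) h &
    forall phi, hsq (T phi) <= C * hsq phi].
  apply: (riesz_form eo te C0 (q := fun phi psi => scalar_integral (povm_measure nu phi psi) h)).
  - by move=> a x y z; exact: povm_form_linl.
  - by move=> a x y z; exact: povm_form_linr.
  - by move=> x y; exact: povm_form_le.
apply: (xgetPex (fun=> 0) (ex_intro (fun S : Q -> Q => bounded_operator S /\ _) T _)); split => //.
by apply: (hsq_bounded (C := Num.sqrt C)) => // x; rewrite sqr_sqrtr.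
Qed.

Lemma povm_integral_nonneg (e : nat -> Q) h (C : R) :
  onz inner e -> total (range e) -> sbm h -> 0 <= C -> (forall x, sc_nm (h x) ^+ 2 <= C) ->
  (forall x, 0 <= h x) -> nonneg_operator (povm_integral nu h).
Proof.
move=> eo te bh C0 hC h0; have [_ TE] := povm_integralP eo te bh C0 hC.
split=> [x y|x]; last by rewrite TE povm_form_ge0.
rewrite TE inner_conj TE -povm_form_conj//; congr scalar_integral.
by apply/funext => u; rewrite sc_conj_ge0.
Qed.
End Povm.

(** * Functions in the RKHS *)

Lemma nat_pairing : exists p : nat -> nat * nat, injective p /\ forall ij, exists n, p n = ij.
Proof.
have /card_set_bijP[p [_ pi ps]] : ([set: nat] #= [set: nat * nat])%card.
  by rewrite card_eq_sym; exact: card_nat2.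
exists p; split => [m n|ij]; first by apply: pi; rewrite inE.
by have [n _ <-] := ps ij I; exists n.
Qed.

Section Rkhs.
Context {X : ptopologicalType} {R : realType} {k : scalar_kind}.
Local Notation F := (scalarField R k).
Context {K : X -> X -> F} (K_C0 : C0_kernel K) (HK : rkhs K).
Implicit Types (f g : HK) (x y : X).
Local Notation sP := (@inner_semi R k HK).

Definition kernel_sup : R := sup (range (fun x => sc_re (K x x))).

Lemma kernelE x y : K x y = inner (rk_feature HK y) (rk_feature HK x).
Proof. by rewrite -rk_reproducing rk_featureE. Qed.

Lemma kernel_diag x : K x x = sc_ofR (hsq (rk_feature HK x)).
Proof. by rewrite kernelE inner_hsq. Qed.

Lemma hsq_feature_le x : hsq (rk_feature HK x) <= kernel_sup.
Proof.
case: K_C0 => _ ub _; apply: (ub_le_sup ub); exists x => //.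
by rewrite kernel_diag sc_re_ofR.
Qed.

Lemma kernel_sup_ge0 : 0 <= kernel_sup.
Proof. exact: le_trans (hsq_ge0 _) (hsq_feature_le point). Qed.

Lemma rk_fun_le f x : sc_nm (rk_fun f x) ^+ 2 <= kernel_sup * hsq f.
Proof.
rewrite rk_reproducing; apply: le_trans (inner_cs _ _) _.
by rewrite mulrC ler_wpM2r ?hsq_ge0// hsq_feature_le.
Qed.

(** A dense sequence u need not consist of features. For each i and n a feature within squared
    distance 1/(n+1) of [u i] is chosen when there is one; every feature is then a limit of chosen
    ones. A vector orthogonal to them is a function that vanishes everywhere, hence 0. *)
Lemma features_total : separable HK ->
  exists s : nat -> X, total (range (fun n => rk_feature HK (s n))).
Proof.
move=> /separable_seq[u /dense_hsq du].
have [p [_ ps]] := nat_pairing.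
pose s m := xget point [set x | hsq (rk_feature HK x - u (p m).1) < (p m).2.+1%:R^-1].
exists s; pose v n := rk_feature HK (s n).
pose g := gram_schmidt inner v.
have go := gram_schmidt_onz sP v.
have tg : total (range g).
  apply: orthocomplement_total => // f fg.
  have fv n : inner f (v n) = 0.
    have /hsq_eq0/eqP := gram_schmidt_res sP v n; rewrite subr_eq0 => /eqP ->.
    by rewrite /proj (si_sumr sP) big1// => i _; rewrite innerZr fg mulr0.
  apply: (@rk_fun_inj _ _ _ K); apply/funext => x.
  rewrite !rk_reproducing inner0l; apply: sc_nm_eq0; apply/eqP.
  rewrite -sqrf_eq0 eq_le sqr_ge0 andbT; apply/ler_addgt0Pl => e e0; rewrite addr0.
  have f1 : 0 < 4 * (hsq f + 1) by rewrite mulr_gt0// ltr_wpDl// hsq_ge0.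
  (* Makes 4 (|f|^2 + 1)/(n+1) <= e; the 4 comes from two distances below 1/(n+1) in [hsqD_le]. *)
  pose n := Num.truncn ((4 * (hsq f + 1)) / e).
  have n0 : 0 < n.+1%:R^-1 :> R by rewrite invr_gt0.
  have [_ [i _ <-] xi] := du (rk_feature HK x) _ n0.
  have [m pm] := ps (i, n).
  have sm : hsq (v m - u i) < n.+1%:R^-1.
    have := @xgetPex _ point [set x | hsq (rk_feature HK x - u (p m).1) < (p m).2.+1%:R^-1].
    by rewrite -/(s m) pm /=; apply; exists x.
  have -> : inner f (rk_feature HK x) = inner f (rk_feature HK x - v m).
    by rewrite (siBr sP) fv subr0.
  apply: le_trans (inner_cs _ _) _.
  have xm : hsq (rk_feature HK x - v m) <= 4 * n.+1%:R^-1.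
    have -> : rk_feature HK x - v m = (rk_feature HK x - u i) + (u i - v m).
      by rewrite addrA subrK.
    apply: le_trans (hsqD_le _ _) _; rewrite (hsqBC (u i)).
    by move: xi sm; move: (n.+1%:R^-1) => q; lra.
  apply: (@le_trans _ _ ((hsq f + 1) * (4 * n.+1%:R^-1))).
    by rewrite ler_pM ?hsq_ge0// lerDl.
  rewrite mulrA [(_ + 1) * 4]mulrC ler_pdivrMr// -[leRHS]mulrC -ler_pdivrMr//.
  by apply/ltW; rewrite /n truncnS_gt.
move=> P cP vP; apply: tg => // _ [n _ <-]; case: (cP) => P0 Plin _.
by apply: gram_schmidt_mem => // j; apply: vP; exists j.
Qed.

Lemma continuous_measurable_borel (f : X -> R) :
  continuous f -> measurable_fun [set: borel X] (f : borel X -> R).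
Proof.
move=> /continuousP cf; apply: (measurability _ (RGenOpens.measurableE R)).
move=> _ [_ [a [b ->] <-]]; rewrite setTI; apply: sub_sigma_algebra.
exact/cf/interval_open.
Qed.

Lemma rk_feature_continuous y :
  continuous (fun x => sc_re (K x y)) /\ continuous (fun x => sc_im (K x y)).
Proof.
case: K_C0 => _ _ /(_ y)[cK _]; split => x; apply/cvgrPdist_lt => e e0;
  have e1 : 0 < (sc_ofR e : F) by rewrite sc_ofR_gt0.
- move: (cK x) => /cvgrPdist_lt/(_ _ e1); apply: filterS => z.
  by rewrite -sc_reN -sc_reD; exact: sc_norm_re.
- move: (cK x) => /cvgrPdist_lt/(_ _ e1); apply: filterS => z.
  by rewrite -sc_imN -sc_imD; exact: sc_norm_im.
Qed.

(** Features are continuous, and norm convergence implies pointwise convergence, so the elements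
    with measurable functions form a closed subspace. A pointwise limit of a sequence stays
    measurable. *)
Lemma rk_fun_measurable f : separable HK ->
  measurable_fun [set: borel X] (fun x : borel X => sc_re (rk_fun f x)) /\
  measurable_fun [set: borel X] (fun x : borel X => sc_im (rk_fun f x)).
Proof.
move=> /features_total[s ts].
pose meas (h : borel X -> F) := measurable_fun [set: borel X] (fun x => sc_re (h x)) /\
  measurable_fun [set: borel X] (fun x => sc_im (h x)).
apply: (ts [set f | meas (rk_fun f)]); last first.
  move=> _ [n _ <-] /=; rewrite /meas rk_featureE.
  by have [? ?] := rk_feature_continuous (s n); split; exact: continuous_measurable_borel.
split.
- have E x : rk_fun (0 : HK) x = 0 by rewrite rk_reproducing inner0l.
  rewrite /= /meas; split.
    by under eq_fun do rewrite E; exact: measurable_cst.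
  by under eq_fun do rewrite E; exact: measurable_cst.
- move=> a u v [ur ui] [vr vi]; split.
    under eq_fun do rewrite rk_fun_linear sc_reD sc_reM.
    apply: measurable_funD => //; apply: measurable_funB; apply: measurable_funM => //;
      exact: measurable_cst.
  under eq_fun do rewrite rk_fun_linear sc_imD sc_imM.
  apply: measurable_funD => //; apply: measurable_funD; apply: measurable_funM => //;
      exact: measurable_cst.
- move=> g h.
  have /choice[w wP] (n : nat) : exists v, meas (rk_fun v) /\ hsq (g - v) < n.+1%:R^-1 ^+ 2.
    have e0 : 0 < n.+1%:R^-1 ^+ 2 :> R by rewrite exprn_gt0// invr_gt0.
    by have [v vm vg] := h _ e0; exists v.
  have wg (x : X) : (fun n => rk_fun (w n) x) @ \oo --> rk_fun g x.
    apply/sc_cvgP => e e0; have M0 := kernel_sup_ge0.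
    have M1 : 0 < Num.sqrt kernel_sup + 1 by rewrite ltr_wpDl// sqrtr_ge0.
    exists (Num.truncn ((Num.sqrt kernel_sup + 1) / e)).+1 => // n /= nN.
    have -> : rk_fun (w n) x - rk_fun g x = - rk_fun (g - w n) x.
      by rewrite !rk_reproducing (siBl sP) opprB.
    rewrite sc_nmN.
    have n1 : 0 < n.+1%:R^-1 :> R by rewrite invr_gt0.
    have h1 : sc_nm (rk_fun (g - w n) x) <= Num.sqrt kernel_sup * n.+1%:R^-1.
      rewrite -ler_sqr ?nnegrE ?sc_nm_ge0 ?mulr_ge0 ?sqrtr_ge0 ?(ltW n1)//.
      rewrite exprMn sqr_sqrtr//; apply: le_trans (rk_fun_le _ _) _.
      by rewrite ler_wpM2l// ltW//; case: (wP n).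
    apply: le_lt_trans h1 _; rewrite ltr_pdivrMr// mulrC -ltr_pdivrMr//.
    apply: (@le_lt_trans _ _ ((Num.sqrt kernel_sup + 1) / e)).
      by rewrite ler_pM2r ?invr_gt0// lerDl.
    by apply: lt_le_trans (truncnS_gt _) _; rewrite ler_nat (leq_trans nN).
  split; apply: measurable_fun_cvg.
  + by move=> n; case: (wP n) => -[wr _] _; exact: wr.
  + by move=> x _; exact: cvg_sc_re (wg x).
  + by move=> n; case: (wP n) => -[_ wi] _; exact: wi.
  + by move=> x _; exact: cvg_sc_im (wg x).
Qed.

Lemma rk_fun_sbm f : separable HK ->
  sc_bounded_measurable (rk_fun f : borel X -> F).
Proof.
move=> HK_sep; have [mr mi] := rk_fun_measurable f HK_sep.
have fb x : sc_nm (rk_fun f x) <= Num.sqrt (kernel_sup * hsq f).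
  by rewrite -(ger0_norm (sc_nm_ge0 _)) -sqrtr_sqr ler_wsqrtr// rk_fun_le.
split; split => //; exists (Num.sqrt (kernel_sup * hsq f)) => x.
  exact: le_trans (sc_re_le_nm _) (fb x).
exact: le_trans (sc_im_le_nm _) (fb x).
Qed.

(** Parseval for the feature at x, whose coefficients have modulus |f_i(x)|. An approximating list
    is contained in an initial segment, and larger segments do no worse. *)
Lemma kernel_diag_cvg (f : nat -> HK) x : onz inner f -> total (range f) ->
  (fun n => \sum_(0 <= i < n) sc_nm (rk_fun (f i) x) ^+ 2) @ \oo --> sc_re (K x x).
Proof.
move=> fo tf; rewrite kernel_diag sc_re_ofR; apply/cvgrPdist_lt => e e0.
have [r ur re] := total_approximable (rk_feature HK x) fo tf e0.
have [N rN] : exists N, forall i, i \in r -> (i < N)%N.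
  exists (\max_(i <- r) i).+1 => i ir; rewrite ltnS.
  exact: (@leq_bigmax_seq _ r xpredT id).
exists N => // n /= Nn.
have uN : uniq (index_iota 0 n) by exact: iota_uniq.
have E : \sum_(0 <= i < n) sc_nm (rk_fun (f i) x) ^+ 2 =
    \sum_(i <- index_iota 0 n) sc_nm (inner (rk_feature HK x) (f i)) ^+ 2.
  by apply: eq_bigr => i _; rewrite rk_reproducing inner_conj sc_nm_conj.
have := form_sq_res sP fo (rk_feature HK x) uN; rewrite -E => <-.
rewrite ger0_norm ?(form_sq_ge0 sP)//; apply: le_lt_trans re.
apply: (form_sq_res_sub sP fo) => // i ir; rewrite mem_index_iota /=.
exact: leq_trans (rN i ir) Nn.
Qed.

(** The diagonal is not given as a function of the space; it is measurable as a pointwise limit of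
    finite sums of |f_i|^2. *)
Lemma kernel_diag_sbm : separable HK ->
  sc_bounded_measurable ((fun x => K x x) : borel X -> F).
Proof.
move=> HK_sep; have [u du] := separable_seq HK_sep.
pose f := gram_schmidt inner u; have fo := gram_schmidt_onz sP u.
have tf : total (range f) := gram_schmidt_total (dense_total du).
split; last first.
  have -> : (fun x => sc_im (K x x)) = fun=> 0.
    by apply/funext => x; rewrite kernel_diag sc_im_ofR.
  exact: bm_cst.
split; last first.
  exists kernel_sup => x; rewrite kernel_diag sc_re_ofR ger0_norm ?hsq_ge0//.
  exact: hsq_feature_le.
apply: (measurable_fun_cvg (h := fun n (x : borel X) => \sum_(0 <= i < n) sc_nm (rk_fun (f i) x) ^+ 2)).
  move=> n; apply: measurable_sum => i.
  under eq_fun do rewrite sc_nm_sqrE.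
  have [mr mi] := rk_fun_measurable (f i) HK_sep.
  by apply: measurable_funD; apply: measurable_funX.
by move=> x _; exact: kernel_diag_cvg.
Qed.
End Rkhs.

(** * Tensor products and the operator *)

Lemma closed_subspace_preim (R : realType) (k : scalar_kind) (V W : hilbertType R k)
    (L : V -> W) (P : set W) (C : R) :
  linear L -> (forall x, hsq (L x) <= C * hsq x) -> closed_subspace P ->
  closed_subspace [set x | P (L x)].
Proof.
move=> Ll LC [P0 Pl Pc].
have L0 : L 0 = 0 by apply: hsq_eq0; apply/eqP; rewrite eq_le hsq_ge0 andbT -[leRHS](mulr0 C) -(@hsq0 _ _ V) LC.
have LB x y : L (x - y) = L x - L y.
  by rewrite addrC -scaleN1r Ll scaleN1r addrC.
split=> /= [|a x y Px Py|x h]; [by rewrite L0|by rewrite Ll; exact: Pl|].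
apply: Pc => e e0; have C1 : 0 < `|C| + 1 by rewrite ltr_wpDl.
have [y Py xy] := h _ (divr_gt0 e0 C1); exists (L y) => //.
rewrite -LB; apply: le_lt_trans (LC _) _.
apply: (@le_lt_trans _ _ ((`|C| + 1) * hsq (x - y))).
  by rewrite ler_wpM2r ?hsq_ge0// (le_trans (ler_norm _))// lerDl.
by rewrite mulrC -ltr_pdivlMr.
Qed.

Section Tensor.
Context {R : realType} {k : scalar_kind} {H1 H2 : hilbertType R k}.
Context (H : hilbert_tensor H1 H2).
Implicit Types (f : H1) (phi : H2).

Lemma hsq_tensor f phi : hsq (tensor H f phi) = hsq f * hsq phi.
Proof. by rewrite {1}/hsq /form_sq tensor_inner !inner_hsq -sc_ofRM sc_re_ofR. Qed.

Lemma tensor_total {I J : Type} (f : I -> H1) (e : J -> H2) :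
  total (range f) -> total (range e) ->
  total (range (fun ij : I * J => tensor H (f ij.1) (e ij.2))).
Proof.
move=> tf te P cP fP.
have fe g j : P (tensor H g (e j)).
  apply: (tf [set g | P (tensor H g (e j))]); last first.
    by move=> _ [i _ <-]; apply: fP; exists (i, j).
  apply: (closed_subspace_preim (C := hsq (e j))) => // [|x]; first exact: tensor_linear_l.
  by rewrite hsq_tensor mulrC.
have td := lin_span_dense_total (@tensor_dense _ _ _ _ H).
apply: (td P) => // _ [g [phi ->]].
apply: (te [set phi | P (tensor H g phi)]); last by move=> _ [j _ <-]; exact: fe.
apply: (closed_subspace_preim (C := hsq g)) => // [|x]; first exact: tensor_linear_r.
by rewrite hsq_tensor.
Qed.

Lemma tensor0l phi : tensor H 0 phi = 0.
Proof. by apply: hsq_eq0; rewrite hsq_tensor hsq0 mul0r. Qed.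

Lemma tensor0r f : tensor H f 0 = 0.
Proof. by apply: hsq_eq0; rewrite hsq_tensor hsq0 mulr0. Qed.

Lemma tensor_onz {I J : eqType} (f : I -> H1) (e : J -> H2) :
  onz inner f -> onz inner e ->
  onz inner (fun ij : I * J => tensor H (f ij.1) (e ij.2)).
Proof.
move=> fo eo; split=> [[i j] [i' j'] /= ij|[i j] /=]; rewrite tensor_inner.
  have [ii|/eqP ii] := eqVneq i i'; last by rewrite fo.1 ?mul0r.
  have [jj|/eqP jj] := eqVneq j j'; last by rewrite eo.1 ?mulr0.
  by case: ij; rewrite ii jj.
have [->|->] := fo.2 i; first by left; rewrite tensor0l.
have [->|->] := eo.2 j; first by left; rewrite tensor0r.
by right; rewrite mulr1.
Qed.
End Tensor.

Arguments tensor_total {R k H1 H2} H {I J f e} _ _ _.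

(** * The sesquilinear form defined by [nu], its matrix and its extension to all tensors *)

Section KernelPovm.
Context {X : ptopologicalType} {R : realType} {k : scalar_kind}.
Local Notation F := (scalarField R k).
Context {Q : hilbertType R k} {K : X -> X -> F} (K_C0 : C0_kernel K).
Context (HK : rkhs K) (HK_sep : separable HK) (HKQ : hilbert_tensor HK Q).
Context (nu : povm (borel X) Q).
Implicit Types (f g : HK) (phi psi : Q).
Local Notation M := (@kernel_sup X R k K).

Definition kpovm f g phi psi : F :=
  scalar_integral (povm_measure nu phi psi) (fun x => rk_fun f x * sc_conj (rk_fun g x)).

Lemma rk_mul_sbm f g :
  sc_bounded_measurable ((fun x => rk_fun f x * sc_conj (rk_fun g x)) : borel X -> F).
Proof. by apply: sbmM; [|apply: sbm_conj]; exact: rk_fun_sbm. Qed.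

Lemma kpovm_le f g phi psi :
  sc_nm (kpovm f g phi psi) ^+ 2 <= M ^+ 2 * hsq f * hsq g * hsq phi * hsq psi.
Proof.
have M0 := kernel_sup_ge0 K_C0 HK.
apply: povm_form_le => [||x]; [exact: rk_mul_sbm|by rewrite !mulr_ge0 ?hsq_ge0 ?sqr_ge0|].
rewrite sc_nmM sc_nm_conj exprMn.
have -> : M ^+ 2 * hsq f * hsq g = (M * hsq f) * (M * hsq g) by ring.
by rewrite ler_pM ?sqr_ge0//; exact: rk_fun_le.
Qed.

Lemma kpovm_conj f g phi psi : kpovm g f psi phi = sc_conj (kpovm f g phi psi).
Proof.
rewrite /kpovm -povm_form_conj; last exact: rk_mul_sbm.
congr scalar_integral; apply/funext => x.
by rewrite sc_conjM sc_conjK mulrC.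
Qed.

Lemma kpovm_lin1 a f f' g phi psi :
  kpovm (a *: f + f') g phi psi = a * kpovm f g phi psi + kpovm f' g phi psi.
Proof.
rewrite /kpovm -scalar_integral_lin; try exact: rk_mul_sbm.
by congr scalar_integral; apply/funext => x; rewrite rk_fun_linear; ring.
Qed.

Lemma kpovm_lin2 a f g g' phi psi :
  kpovm f (a *: g + g') phi psi = sc_conj a * kpovm f g phi psi + kpovm f g' phi psi.
Proof. by rewrite (kpovm_conj (_ + _)) kpovm_lin1 sc_conjD sc_conjM -!kpovm_conj. Qed.

Lemma kpovm_lin3 a f g phi phi' psi :
  kpovm f g (a *: phi + phi') psi = a * kpovm f g phi psi + kpovm f g phi' psi.
Proof. by rewrite /kpovm povm_form_linl//; exact: rk_mul_sbm. Qed.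

Lemma kpovm_lin4 a f g phi psi psi' :
  kpovm f g phi (a *: psi + psi') = sc_conj a * kpovm f g phi psi + kpovm f g phi psi'.
Proof. by rewrite /kpovm povm_form_linr//; exact: rk_mul_sbm. Qed.

Section Matrix.
Context (f : nat -> HK) (fo : onz inner f) (e : nat -> Q) (eo : onz inner e).
Context (p : nat -> nat * nat) (p_inj : injective p).

Let t a b := kpovm (f (p a).1) (f (p b).1) (e (p a).2) (e (p b).2).

(** The vector w_B of the cell [u], with the first n coefficients read along [p]. *)
Definition cell_vec (P : tagged_partition (borel X)) n (c : nat -> F) (u : tp_index P) : Q :=
  \sum_(0 <= a < n) (c a * rk_fun (f (p a).1) (tp_tag u)) *: e (p a).2.

Lemma matrix_riemann n (c : nat -> F) : exists P : nat -> tagged_partition (borel X),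
  (fun m => \sum_u cell_form nu u (@cell_vec (P m) n c u) (@cell_vec (P m) n c u)) @ \oo -->
  (\sum_(0 <= a < n) \sum_(0 <= b < n) c a * sc_conj (c b) * t a b : F).
Proof.
(* All n^2 integrands share the partitions, so the double sum can be regrouped cell by cell. *)
have [P PP] := riemann_cvg (fun ab : 'I_n * 'I_n => rk_mul_sbm (f (p ab.1).1) (f (p ab.2).1)).
exists P.
have -> : (fun m => \sum_u cell_form nu u (@cell_vec (P m) n c u) (@cell_vec (P m) n c u)) =
  (fun m => \sum_(a < n) \sum_(b < n) c a * sc_conj (c b) *
    riemann_sum (P m) (povm_measure nu (e (p a).2) (e (p b).2))
      (fun x => rk_fun (f (p a).1) x * sc_conj (rk_fun (f (p b).1) x))).
  apply/funext => m; transitivity (\sum_(u : tp_index (P m)) \sum_(a < n) \sum_(b < n)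
     c a * sc_conj (c b) * (rk_fun (f (p a).1) (tp_tag u) * sc_conj (rk_fun (f (p b).1) (tp_tag u)) *
     cell_form nu u (e (p a).2) (e (p b).2))).
    apply: eq_bigr => u _; have sP := cell_form_semi nu u.
    rewrite /cell_vec (si_suml sP) big_mkord; apply: eq_bigr => a _.
    rewrite (siZl sP) (si_sumr sP) mulr_sumr big_mkord; apply: eq_bigr => b _.
    by rewrite (siZr sP) sc_conjM; ring.
  rewrite exchange_big; apply: eq_bigr => a _; rewrite exchange_big; apply: eq_bigr => b _.
  by rewrite riemann_povmE mulr_sumr.
rewrite big_mkord; apply: sc_cvg_sum => a; rewrite big_mkord; apply: sc_cvg_sum => b.
by apply: cvgM; [exact: cvg_cst|exact: (PP (a, b))].
Qed.

(* Grouping the indices [a] by [i = (p a).1] writes the cell vector as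
   [sum_i f_i(x) phi_i]; Cauchy-Schwarz and Bessel bound the cell form by
   [K x x sum_i <nu(B) phi_i, phi_i>]. *)
Lemma cell_vec_le (P : tagged_partition (borel X)) n (c : nat -> F) :
  \sum_u form_sq (cell_form nu u) (@cell_vec P n c u) <=
  M * \sum_(0 <= a < n) sc_nm (c a) ^+ 2.
Proof.
have sQ := @inner_semi R k Q; have sH := @inner_semi R k HK.
have M0 := kernel_sup_ge0 K_C0 HK.
pose N := (\max_(a < n) (p a).1).+1.
have pN a : (a < n)%N -> ((p a).1 < N)%N.
  by move=> an; rewrite ltnS; exact: (@leq_bigmax _ (fun a : 'I_n => (p a).1) (Ordinal an)).
(* For fixed i only the indices a with first component i are kept. Injectivity of [p] makes their
   second components distinct, so [e' i] is orthonormal although a vector of e can occur for several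
   a. *)
pose c' i a : F := if i == (p a).1 then c a else 0.
pose e' i a : Q := if i == (p a).1 then e (p a).2 else 0.
have eo' i : onz inner (e' i).
  split=> [a b ab|a]; rewrite /e'; last by case: ifP => _; [exact: eo.2|left].
  case: eqP => ia; last exact: inner0l.
  case: eqP => ib; last exact: (si0r sQ).
  rewrite eo.1// => ej; apply/ab/p_inj.
  by rewrite (surjective_pairing (p a)) (surjective_pairing (p b)) -ia -ib ej.
pose phi i := \sum_(0 <= a < n) c' i a *: e' i a.
have pick (V : zmodType) (G : nat -> V) a : (a < n)%N ->
    \sum_(0 <= i < N) (if i == (p a).1 then G i else 0) = G (p a).1.
  by move=> an; rewrite -big_mkcond big_nat1_eq /= pN.
have vE u : @cell_vec P n c u = \sum_(0 <= i < N) rk_fun (f i) (tp_tag u) *: phi i.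
  transitivity (\sum_(0 <= a < n) \sum_(0 <= i < N)
      (if i == (p a).1 then (c a * rk_fun (f i) (tp_tag u)) *: e (p a).2 else 0)).
    apply: eq_big_seq => a; rewrite mem_index_iota => /= an; apply/esym.
    exact: (pick Q (fun i => (c a * rk_fun (f i) (tp_tag u)) *: e (p a).2)).
  rewrite exchange_big/=; apply: eq_bigr => i _; rewrite /phi scaler_sumr.
  apply: eq_bigr => a _; rewrite /c' /e'.
  by case: eqP => _; rewrite ?scaler0// scalerA mulrC.
have phi_le i : hsq (phi i) <= \sum_(0 <= a < n) sc_nm (c' i a) ^+ 2.
  by apply: onz_comb_hsq => //; exact: iota_uniq.
apply: (@le_trans _ _ (\sum_u M * \sum_(0 <= i < N) form_sq (cell_form nu u) (phi i))).
  apply: ler_sum => u _; have sU := cell_form_semi nu u.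
  rewrite vE; apply: le_trans (form_sq_comb sU _ _ _) _.
  rewrite ler_wpM2r//; first by apply: sumr_ge0 => i _; exact: form_sq_ge0.
  apply: le_trans (hsq_feature_le K_C0 HK (tp_tag u)).
  have := bessel sH fo (rk_feature HK (tp_tag u)) (iota_uniq 0 (N - 0)).
  apply: le_trans; apply: ler_sum => i _.
  by rewrite rk_reproducing inner_conj sc_nm_conj.
rewrite -mulr_sumr ler_wpM2l// exchange_big/=.
apply: (@le_trans _ _ (\sum_(0 <= i < N) \sum_(0 <= a < n) sc_nm (c' i a) ^+ 2)).
  by apply: ler_sum => i _; rewrite cell_form_sum.
rewrite exchange_big/= [leLHS]big_seq [leRHS]big_seq; apply: ler_sum => a.
rewrite mem_index_iota => /= an; rewrite -(pick _ (fun=> sc_nm (c a) ^+ 2) a an).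
by apply: ler_sum => i _; rewrite /c'; case: eqP => // _; rewrite sc_nm0 expr0n.
Qed.

Lemma matrix_ge0 n (c : nat -> F) :
  0 <= \sum_(0 <= a < n) \sum_(0 <= b < n) c a * sc_conj (c b) * t a b.
Proof.
have [P PP] := matrix_riemann n c; apply: (sc_cvg_ge0 PP) => m.
by apply: sumr_ge0 => u _; exact: si_ge0 (cell_form_semi nu u) _.
Qed.

Lemma matrix_le n (c : nat -> F) :
  sc_re (\sum_(0 <= a < n) \sum_(0 <= b < n) c a * sc_conj (c b) * t a b) <=
  M * \sum_(0 <= a < n) sc_nm (c a) ^+ 2.
Proof.
have [P PP] := matrix_riemann n c; apply: (sc_cvg_re_le PP) => m.
by rewrite sc_re_sumr; exact: cell_vec_le.
Qed.
End Matrix.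

Section Multilinear.
Context (f : nat -> HK) (tf : total (range f)) (e : nat -> Q) (te : total (range e)).

(* Both sides are bounded and (conjugate-)linear in each of the four variables. *)
Lemma kpovm_ext (T : HKQ -> HKQ) (C : R) : linear T -> 0 <= C ->
  (forall x, hsq (T x) <= C * hsq x) ->
  (forall i i' j j', inner (T (tensor HKQ (f i) (e j))) (tensor HKQ (f i') (e j')) =
     kpovm (f i) (f i') (e j) (e j')) ->
  forall g g' phi psi, inner (T (tensor HKQ g phi)) (tensor HKQ g' psi) = kpovm g g' phi psi.
Proof.
move=> Tl C0 TC Tb; have M0 := kernel_sup_ge0 K_C0 HK.
pose D g g' phi psi := inner (T (tensor HKQ g phi)) (tensor HKQ g' psi) - kpovm g g' phi psi.
suff DZ g g' phi psi : D g g' phi psi = 0.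
  by move=> g g' phi psi; apply/eqP; rewrite -subr_eq0; apply/eqP; exact: DZ.
(* From (a + b)^2 <= 2 (a^2 + b^2), with C bounding the term of T and M^2 that of [kpovm]. *)
pose B := 2 * (C + M ^+ 2).
have DB x y u v : sc_nm (D x y u v) ^+ 2 <= B * hsq x * hsq y * hsq u * hsq v.
  apply: (@le_trans _ _ ((sc_nm (inner (T (tensor HKQ x u)) (tensor HKQ y v)) +
      sc_nm (kpovm x y u v)) ^+ 2)).
    by rewrite lerXn2r ?nnegrE ?addr_ge0 ?sc_nm_ge0// -(sc_nmN (kpovm _ _ _ _)) sc_nmD.
  have h1 := inner_cs (T (tensor HKQ x u)) (tensor HKQ y v).
  have h2 : hsq (T (tensor HKQ x u)) * hsq (tensor HKQ y v) <= C * hsq x * hsq y * hsq u * hsq v.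
    apply: le_trans (ler_wpM2r (hsq_ge0 _) (TC _)) _; rewrite !hsq_tensor.
    by have -> : C * (hsq x * hsq u) * (hsq y * hsq v) = C * hsq x * hsq y * hsq u * hsq v by ring.
  have h3 := kpovm_le x y u v.
  have := sqr_ge0 (sc_nm (inner (T (tensor HKQ x u)) (tensor HKQ y v)) - sc_nm (kpovm x y u v)).
  rewrite /B; lra.
have D1 a x x' y u v : D (a *: x + x') y u v = a * D x y u v + D x' y u v.
  by rewrite /D tensor_linear_l Tl innerP kpovm_lin1; ring.
have D3 a x y u u' v : D x y (a *: u + u') v = a * D x y u v + D x y u' v.
  by rewrite /D tensor_linear_r Tl innerP kpovm_lin3; ring.
have D2 a x y y' u v : D x (a *: y + y') u v = sc_conj a * D x y u v + D x y' u v.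
  by rewrite /D tensor_linear_l innerDr innerZr kpovm_lin2; ring.
have D4 a x y u v v' : D x y u (a *: v + v') = sc_conj a * D x y u v + D x y u v'.
  by rewrite /D tensor_linear_r innerDr innerZr kpovm_lin4; ring.
have s1 i' j j' x : D x (f i') (e j) (e j') = 0.
  apply: (@tf [set x | D x (f i') (e j) (e j') = 0] _ _ x).
    apply: (ker_closed_subspace (theta := id) (C := B * hsq (f i') * hsq (e j) * hsq (e j'))) => //.
    by move=> z; apply: le_trans (DB _ _ _ _) _; rewrite !(mulrAC _ (hsq z)).
  by move=> _ [i _ <-] /=; rewrite /D Tb subrr.
have s2 j j' x y : D x y (e j) (e j') = 0.
  apply: (@tf [set y | D x y (e j) (e j') = 0] _ _ y); last by move=> _ [i _ <-]; exact: s1.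
  apply: (ker_closed_subspace (theta := sc_conj) (C := B * hsq x * hsq (e j) * hsq (e j'))) => //.
  by move=> z; apply: le_trans (DB _ _ _ _) _; rewrite !(mulrAC _ (hsq z)).
have s3 j' x y u : D x y u (e j') = 0.
  apply: (@te [set u | D x y u (e j') = 0] _ _ u); last by move=> _ [i _ <-]; exact: s2.
  apply: (ker_closed_subspace (theta := id) (C := B * hsq x * hsq y * hsq (e j'))) => //.
  by move=> z; apply: le_trans (DB _ _ _ _) _; rewrite !(mulrAC _ (hsq z)).
apply: (@te [set v | D g g' phi v = 0] _ _ psi); last by move=> _ [i _ <-]; exact: s3.
apply: (ker_closed_subspace (theta := sc_conj) (C := B * hsq g * hsq g' * hsq phi)) => //.
Qed.
End Multilinear.

Lemma kernel_povm_operator_uniq (T T' : HKQ -> HKQ) :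
  is_kernel_povm_operator nu T -> is_kernel_povm_operator nu T' -> T = T'.
Proof.
move=> [Tb _ TE] [Tb' _ TE'].
have [C C0 TC] := bounded_hsq Tb; have [C' C0' TC'] := bounded_hsq Tb'.
have td := lin_span_dense_total (@tensor_dense _ _ _ _ HKQ).
pose D x y : F := inner (T x - T' x) y.
have DB x y : sc_nm (D x y) ^+ 2 <= 2 * (C + C') * hsq x * hsq y.
  apply: le_trans (inner_cs _ _) _; rewrite ler_wpM2r ?hsq_ge0//.
  apply: le_trans (hsqD_le _ _) _; rewrite hsqN.
  by have := TC x; have := TC' x; lra.
have s1 f phi y : D (tensor HKQ f phi) y = 0.
  apply: (td [set y | D (tensor HKQ f phi) y = 0] _ _ y); last first.
    by move=> _ [g [psi ->]] /=; rewrite /D innerDl innerNl TE TE' subrr.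
  apply: (ker_closed_subspace (theta := sc_conj) (C := 2 * (C + C') * hsq (tensor HKQ f phi))) => //.
  by move=> a u v; rewrite /D innerDr innerZr.
apply/funext => x; apply/eqP; rewrite -subr_eq0; apply/eqP; apply: inner_ext => y.
rewrite inner0l; apply: (td [set x | D x y = 0] _ _ x); last by move=> _ [g [psi ->]]; exact: s1.
apply: (ker_closed_subspace (theta := id) (C := 2 * (C + C') * hsq y)) => //.
  move=> a u v; rewrite /D Tb.1 Tb'.1 -innerP; congr inner.
  by rewrite scalerBr opprD addrACA.
by move=> z; apply: le_trans (DB _ _) _; rewrite mulrAC.
Qed.
End KernelPovm.

(** * Existence of the operator and the trace identity *)

Section TraceFormula.
Context {X : ptopologicalType} {R : realType} {k : scalar_kind}.
Local Notation F := (scalarField R k).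
Context {Q : hilbertType R k} {K : X -> X -> F} (K_C0 : C0_kernel K).
Context (HK : rkhs K) (HK_sep : separable HK) (HKQ : hilbert_tensor HK Q).
Context (nu : povm (borel X) Q).
Local Notation M := (@kernel_sup X R k K).
Context (f : nat -> HK) (fo : onz inner f) (tf : total (range f)).
Context (e : nat -> Q) (eo : onz inner e) (te : total (range e)).

Lemma kernel_povm_operator_exists : exists T : HKQ -> HKQ,
  is_kernel_povm_operator nu T /\ forall x, hsq (T x) <= M ^+ 2 * hsq x.
Proof.
have M0 := kernel_sup_ge0 K_C0 HK.
have [p [pi ps]] := nat_pairing.
pose b (n : nat) := tensor HKQ (f (p n).1) (e (p n).2).
have bo : onz inner b.
  have [oo ou] := tensor_onz HKQ fo eo.
  by split=> [m n mn|n]; [apply: (oo (p m) (p n)) => /pi|exact: (ou (p n))].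
have tb : total (range b).
  have tt := tensor_total HKQ tf te.
  move=> P cP bP; apply: (tt P) => // _ [ij _ <-].
  by have [n <-] := ps ij; apply: bP; exists n.
have [T [Tl Tn TE TC]] : exists T : HKQ -> HKQ, [/\ linear T, nonneg_operator T,
    forall a c, inner (T (b a)) (b c) =
      kpovm nu (f (p a).1) (f (p c).1) (e (p a).2) (e (p c).2) &
    forall x, hsq (T x) <= M ^+ 2 * hsq x].
  apply: (matrix_operator bo tb M0 (t := fun a c => kpovm nu _ _ _ _)) => [a c|a c a0|n c|n c].
  - exact: kpovm_conj.
  (* If [b a] is 0, one of its two factors has norm 0, and [kpovm_le] makes the entry vanish. *)
  - have fe0 : hsq (f (p a).1) * hsq (e (p a).2) = 0 by rewrite -(hsq_tensor HKQ) -/(b a) a0 hsq0.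
    apply: sc_nm_eq0; apply/eqP; rewrite -sqrf_eq0 eq_le sqr_ge0 andbT.
    apply: le_trans (kpovm_le K_C0 HK_sep nu _ _ _ _) _.
    by rewrite (mulrAC _ (hsq (f (p c).1))) -(mulrA _ (hsq (f (p a).1))) fe0 mulr0 !mul0r.
  - exact: matrix_ge0.
  - exact: matrix_le.
exists T; split => //; split => //; first exact: hsq_bounded M0 Tl TC.
apply: (kpovm_ext K_C0 HK_sep tf te Tl (sqr_ge0 M) TC) => i i' j j'.
have [a pa] := ps (i, j); have [c pc] := ps (i', j').
by have := TE a c; rewrite /b pa pc.
Qed.

Let S := povm_integral nu (fun x => K x x).

Lemma kernel_diag_nm x : sc_nm (K x x) ^+ 2 <= M ^+ 2.
Proof.
rewrite (kernel_diag HK) sc_nm_ofR ger0_norm ?hsq_ge0// lerXn2r ?nnegrE ?hsq_ge0//.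
  exact: kernel_sup_ge0 K_C0 HK.
exact: hsq_feature_le.
Qed.

Lemma povm_kernel_diagP : bounded_operator S /\
  forall phi psi, inner (S phi) psi = scalar_integral (povm_measure nu phi psi) (fun x => K x x).
Proof.
apply: (povm_integralP nu eo te (kernel_diag_sbm K_C0 HK_sep) (sqr_ge0 M)).
exact: kernel_diag_nm.
Qed.

Lemma povm_kernel_diag_nonneg : nonneg_operator S.
Proof.
have K0 x : 0 <= K x x by rewrite (kernel_diag HK) sc_ofR_ge0 ?hsq_ge0.
exact: (povm_integral_nonneg nu eo te (kernel_diag_sbm K_C0 HK_sep) (sqr_ge0 M) kernel_diag_nm K0).
Qed.

(** The partial sums of |f_i(x)|^2 converge to K(x,x) and stay below M by Bessel, so dominated
    convergence on the Jordan parts exchanges sum and integral. *)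
Lemma kernel_diag_series phi :
  \esum_(i in [set: nat]) (sc_re (kpovm nu (f i) (f i) phi phi))%:E =
  (sc_re (inner (S phi) phi))%:E.
Proof.
have mul_sbm := rk_mul_sbm K_C0 HK_sep.
have sq_ge0 i x : 0 <= rk_fun (f i) x * sc_conj (rk_fun (f i) x) :> F.
  by rewrite sc_mulconj sc_ofR_ge0 ?sqr_ge0.
have t0 i : 0 <= sc_re (kpovm nu (f i) (f i) phi phi).
  by have [] := sc_ge0P (povm_form_ge0 nu phi (mul_sbm (f i) (f i)) (sq_ge0 i)).
rewrite -nneseries_esumT => [|i]; last by rewrite lee_fin.
rewrite povm_kernel_diagP.2; apply/cvg_lim => //.
under eq_fun do rewrite sumEFin.
apply: cvg_EFin; first exact: nearW.
pose mu := povm_measure nu phi phi.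
pose h n x := \sum_(0 <= i < n) sc_nm (rk_fun (f i) x) ^+ 2.
have h_sbm n : sc_bounded_measurable ((fun x => sc_ofR (h n x) : F) : borel X -> F).
  elim: n => [|n ih].
    have -> : (fun x => sc_ofR (h 0%N x) : F) = fun=> 0.
      by apply/funext => x; rewrite /h big_nil sc_ofR0.
    exact: sbm_cst.
  have -> : (fun x => sc_ofR (h n.+1 x) : F) =
      (fun x => sc_ofR (h n x) + rk_fun (f n) x * sc_conj (rk_fun (f n) x)).
    by apply/funext => x; rewrite /h big_nat_recr//= sc_ofRD sc_mulconj.
  exact: sbmD.
have hI n : \sum_(0 <= i < n) sc_re (kpovm nu (f i) (f i) phi phi) =
    sc_re (scalar_integral mu (fun x => sc_ofR (h n x))).
  elim: n => [|n ih].
    (* Linearity with a = -1 shows that the integral of the zero function is 0. *)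
    have := scalar_integral_lin mu (-1) (h_sbm 0%N) (h_sbm 0%N).
    rewrite mulN1r addNr big_nil.
    have -> : (fun x => -1 * sc_ofR (h 0%N x) + sc_ofR (h 0%N x) : F) = fun x => sc_ofR (h 0%N x).
      by apply/funext => x; rewrite /h big_nil sc_ofR0 mulr0 addr0.
    by move=> ->; rewrite sc_re0.
  rewrite big_nat_recr//= ih -sc_reD; congr sc_re.
  rewrite /kpovm -[X in X + _]mul1r -scalar_integral_lin//.
  congr scalar_integral; apply/funext => x.
  by rewrite mul1r /h big_nat_recr//= sc_ofRD sc_mulconj.
(* All integrands are real, so the imaginary charge contributes the same constant, its integral of
   0, to every term and to the limit. *)
rewrite [X in X @ _ --> _](_ : _ =
  fun n => charge_integral (re_charge mu) (fun x => h n x) - charge_integral (im_charge mu) (fun=> 0)).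
  rewrite /scalar_integral sc_re_mk.
  have -> : (fun x => sc_im (K x x)) = fun=> 0.
    by apply/funext => x; rewrite (kernel_diag HK) sc_im_ofR.
  apply: cvgB; last exact: cvg_cst.
  apply: (charge_integral_cvg (C := M)).
  - move=> n; have [[m _] _] := h_sbm n; move: m.
    by under eq_fun do rewrite sc_re_ofR.
  - by have [[]] := kernel_diag_sbm K_C0 HK_sep.
  - move=> n x; rewrite ger0_norm; last by apply: sumr_ge0 => i _; exact: sqr_ge0.
    apply: le_trans (hsq_feature_le K_C0 HK x).
    have := bessel (@inner_semi R k HK) fo (rk_feature HK x) (iota_uniq 0 (n - 0)).
    apply: le_trans; apply: ler_sum => i _.
    by rewrite rk_reproducing inner_conj sc_nm_conj.
  - by move=> x; exact: kernel_diag_cvg.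
apply/funext => n; rewrite /= hI /scalar_integral sc_re_mk.
congr (_ - _); congr charge_integral; apply/funext => x.
  by rewrite sc_re_ofR.
by rewrite sc_im_ofR.
Qed.

Lemma kernel_povm_trace_norm (T : HKQ -> HKQ) :
  is_kernel_povm_operator nu T -> trace_norm T = trace_norm S.
Proof.
move=> [Tb Tn TE]; have [Sb _] := povm_kernel_diagP; have Sn := povm_kernel_diag_nonneg.
have [p [pi ps]] := nat_pairing.
pose b ij := tensor HKQ (f ij.1) (e ij.2).
have bo : onz inner b := tensor_onz HKQ fo eo.
have tb : total (range b) := tensor_total HKQ tf te.
(* [trace_norm_frame] asks for a sequence, which [b \o p] provides; the trace itself is summed over
   the pairs, so that it can be split into rows. *)
have bpo : onz inner (b \o p).
  by have [oo ou] := bo; split=> [m n mn|n]; [apply: (oo (p m) (p n)) => /pi|exact: (ou (p n))].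
have tbp : total (range (b \o p)).
  move=> P cP bP; apply: tb => // _ [ij _ <-].
  by have [n <-] := ps ij; apply: bP; exists n.
rewrite (trace_norm_frame bpo tbp Tb Tn (fun y => total_parseval y bo tb)).
rewrite (trace_norm_frame eo te Sb Sn (fun y => total_parseval y eo te)).
have t0 ij : (0 <= (sc_re (inner (T (b ij)) (b ij)))%:E)%E.
  by rewrite lee_fin; have [] := sc_ge0P (Tn.2 (b ij)).
transitivity (\esum_(i in [set: nat]) \esum_(j in [set: nat]) (sc_re (inner (T (b (i, j))) (b (i, j))))%:E).
  rewrite esum_esum//.
  have -> : [set: nat] `*`` (fun=> [set: nat]) = [set: nat * nat] by apply/seteqP; split.
  by apply: eq_esum => -[i j] _.
rewrite esum_swap//; apply: eq_esum => j _.
by rewrite -kernel_diag_series; apply: eq_esum => i _; rewrite TE.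
Qed.
End TraceFormula.

Lemma op_norm_le (R : realType) (k : scalar_kind) (H : hilbertType R k) (T : H -> H) (C : R) :
  0 <= C -> (forall x, hsq (T x) <= C ^+ 2 * hsq x) -> op_norm T <= C.
Proof.
move=> C0 TC; apply: ge_sup.
  by exists (sc_re `|T 0|), 0 => //=; rewrite normr0.
move=> _ [x /= x1 <-]; rewrite -[leRHS](@sc_re_ofR R k).
apply: sc_le; apply: le_trans (hsq_norm_le C0 (TC x)) _.
by rewrite ler_piMr ?sc_ofR_ge0.
Qed.

Theorem theorem3p2 (R : realType) (k : scalar_kind) (X : ptopologicalType)
    (X_lc : locally_compact [set: X]) (X_haus : hausdorff_space X)
    (Q : hilbertType R k) (Q_sep : separable Q)
    (K : X -> X -> scalarField R k) (K_C0 : C0_kernel K)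
    (HK : rkhs K) (HK_sep : separable HK)
    (HKQ : hilbert_tensor HK Q)
    (nu : povm (borel X) Q) :
  let S := povm_integral nu (fun x => K x x) in
  (exists! T : HKQ -> HKQ, is_kernel_povm_operator nu T) /\
  forall T : HKQ -> HKQ, is_kernel_povm_operator nu T ->
    [/\ op_norm T <= sup (range (fun x => sc_re (K x x))),
        trace_class T <-> trace_class S
      & trace_class T -> trace_norm T = trace_norm S].
Proof.
move=> S.
have [u /dense_total tu] := separable_seq HK_sep.
have [v /dense_total tv] := separable_seq Q_sep.
pose f := gram_schmidt inner u; pose e := gram_schmidt inner v.
have fo : onz inner f := gram_schmidt_onz (@inner_semi R k HK) u.
have eo : onz inner e := gram_schmidt_onz (@inner_semi R k Q) v.
have tf : total (range f) := gram_schmidt_total tu.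
have te : total (range e) := gram_schmidt_total tv.
have [T0 [T0P T0C]] := kernel_povm_operator_exists K_C0 HK_sep HKQ nu fo tf eo te.
split; first by exists T0; split => // T; exact: kernel_povm_operator_uniq.
move=> T TP; have TT0 : T = T0 by exact: kernel_povm_operator_uniq TP T0P.
have tr := kernel_povm_trace_norm K_C0 HK_sep fo tf eo te TP.
have [Sb _] := povm_kernel_diagP K_C0 HK_sep nu eo te.
split.
- by rewrite TT0; apply: op_norm_le T0C; exact: kernel_sup_ge0 K_C0 HK.
- rewrite /trace_class tr; split=> -[_ ?]; split => //.
  by case: TP.
- by [].
Qed.
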